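(* Consider the geometric model of the Lorenz equations, the map $f$, its invariant measure $\mu_f$ and the origin map $O$ described in the context, and let $t_i=ih$. There is a constant $h_{\max}>0$ such that for every $0<h\le h_{\max}$, for $\mu_f$-almost every $x\in[-1/2,1/2]$, for every $u\in\Lambda^{\mathrm{geo}}$ with $O_1(u)=x$, and for every $k\in\mathbb N$, there exist continuous curves $\tilde U(u,k)\subset\Lambda^{\mathrm{geo}}$ (called anti-leaf sets) and constants $\tilde d_{\max}(u,k)\ge0$, $C_{\tilde U}(u,k)<\infty$ such that: 1. $\{\|v(t_k)-u(t_k)\|_\infty: v\in\tilde U(u,k)\}=[0,\tilde d_{\max}(u,k)]$; 2. $\sum_{i=0}^k\|v(t_i)-u(t_i)\|_\infty\le C_{\tilde U}(u,k)\,\|v(t_k)-u(t_k)\|_\infty$ for every $v\in\tilde U(u,k)$; 3. there is an infinite sequence of indices $i_1(u),i_2(u),\ldots$ such that for every $j\ge1$, $C_{\tilde U}(u,i_j(u))\le C_{\tilde U}(u)$ and $\tilde d_{\max}(u,i_j(u))\ge\tilde d_{\max}(u)$, where $\tilde d_{\max}(u)>0$ and $C_{\tilde U}(u)<\infty$ are constants independent of $j$.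
   Context: Geometric model. Parameters: $0<\lambda_3<\lambda_1<\lambda_2$ and $\theta$; put $\alpha=\lambda_3/\lambda_1$, $\beta=\lambda_2/\lambda_1$ and assume $\frac1{\sqrt2}<\alpha<1$, $\beta>\frac{\log 6}{\log 2}-1$, $\frac{2^\alpha}{\sqrt2\,\alpha}<\theta<2^\alpha$. Let $S=\{(u_1,u_2,1):|u_1|\le\frac12,|u_2|\le\frac12\}$, $S^*=\{u\in S:u_1\ne0\}$, $\Gamma=\{u\in S:u_1=0\}$. Linear phase: a path started at $u\in S$ follows $\Psi^{\mathrm{lin}}_t(u)=(u_1e^{\lambda_1t},u_2e^{-\lambda_2t},u_3e^{-\lambda_3t})$ until it reaches $\Sigma=\{|u_1|=1\}$. For $u\in S^*$ this happens at time $\tau_\Sigma(u)=\frac1{\lambda_1}\log(1/|u_1|)$ at the point $(\mathrm{sgn}(u_1),u_2|u_1|^\beta,|u_1|^\alpha)$; paths started on $\Gamma$ follow the linear flow forever and converge to the origin. Rotation phase: from the point $w=(\pm1,w_2,w_3)$ reached on $\Sigma$, with $r(s)=1-w_3+\left(\frac12-(\theta-1)w_3\right)\frac{s}{(3/2)\pi}$, the path for $0\le s\le\frac32\pi$ is $\Psi^{\mathrm{rot}}_s(w)=\left(1+r(s)\sin s,\ w_2-\frac14\frac{s}{(3/2)\pi},\ 1-r(s)\cos s\right)$ if $w_1=1$, and $\Psi^{\mathrm{rot}}_s(w)=\left(-1-r(s)\sin s,\ w_2+\frac14\frac{s}{(3/2)\pi},\ 1-r(s)\cos s\right)$ if $w_1=-1$.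 At $s=\frac32\pi$ the path is back in $S$ and the linear phase starts again. $\Lambda^{\mathrm{geo}}\subset\mathbb R^3$ is the union of all points on paths started in $S$ until their first return to $S$ (including the points on the non-returning paths started on $\Gamma$). $\Psi^{\mathrm{geo}}_t$ is the semigroup on $\Lambda^{\mathrm{geo}}$ obtained by concatenating the two phases, and $u(t):=\Psi^{\mathrm{geo}}_t(u)$, $v(t):=\Psi^{\mathrm{geo}}_t(v)$. Origin: for $v\in\Lambda^{\mathrm{geo}}$, $O(v)=(O_1(v),O_2(v),O_3(v))\in S$ is the unique point of $S$ such that the path of the geometric model started from $O(v)$ passes through $v$ before returning to $S$. The map $f:[-\frac12,\frac12]\setminus\{0\}\to[-\frac12,\frac12]$, $f(x)=\theta|x|^\alpha-\frac12$ for $x>0$ and $f(x)=-\theta|x|^\alpha+\frac12$ for $x<0$, describes the first coordinate of the return map from $S^*$ to $S$. It is a known fact that $f$ has a unique invariant probability measure $\mu_f$ on $[-\frac12,\frac12]$ absolutely continuous with respect to Lebesgue measure; it is ergodic and its density is bounded. *)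

(* Defs.v *)
From HB Require Import structures.
From mathcomp Require Import all_boot all_order all_algebra.
From mathcomp Require Import all_classical all_reals all_analysis.
From mathcomp Require Import ring lra.
Set Implicit Arguments.
Unset Strict Implicit.
Unset Printing Implicit Defensive.
Import Order.TTheory GRing.Theory Num.Theory.
Import numFieldNormedType.Exports.
Local Open Scope classical_set_scope.
Local Open Scope ring_scope.

(* R^3 is [R * R * R]; the library norm and topology of a product type are the
   max norm and the product topology, so [`|v - u|] is the sup-norm distance. *)

Definition crd1 (R : realType) (u : R * R * R) : R := u.1.1.
Definition crd2 (R : realType) (u : R * R * R) : R := u.1.2.
Definition crd3 (R : realType) (u : R * R * R) : R := u.2.

Record geo_params (R : realType) := GeoParams {
  lambda1 : R; lambda2 : R; lambda3 : R; theta : R }.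

Definition alpha (R : realType) (p : geo_params R) : R := lambda3 p / lambda1 p.
Definition beta (R : realType) (p : geo_params R) : R := lambda2 p / lambda1 p.

Record admissible (R : realType) (p : geo_params R) : Prop := Admissible {
  lambda3_gt0 : 0 < lambda3 p;
  lambda31 : lambda3 p < lambda1 p;
  lambda12 : lambda1 p < lambda2 p;
  alpha_gt : 1 / Num.sqrt 2 < alpha p;
  alpha_lt1 : alpha p < 1;
  beta_gt : ln 6 / ln 2 - 1 < beta p;
  theta_gt : 2 `^ alpha p / (Num.sqrt 2 * alpha p) < theta p;
  theta_lt : theta p < 2 `^ alpha p }.

Definition Ssec (R : realType) : set (R * R * R) :=
  [set u | [/\ `|crd1 u| <= 1 / 2, `|crd2 u| <= 1 / 2 & crd3 u = 1]].

Definition lin (R : realType) (p : geo_params R) (t : R) (u : R * R * R)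
    : R * R * R :=
  (crd1 u * expR (lambda1 p * t),
   crd2 u * expR (- (lambda2 p * t)),
   crd3 u * expR (- (lambda3 p * t))).

(* The next two are meaningful for [u] in [Ssec] with [crd1 u != 0] only. *)
Definition tauSigma (R : realType) (p : geo_params R) (u : R * R * R) : R :=
  (lambda1 p)^-1 * ln (1 / `|crd1 u|).

Definition hitSigma (R : realType) (p : geo_params R) (u : R * R * R)
    : R * R * R :=
  (Num.sg (crd1 u), crd2 u * `|crd1 u| `^ beta p, `|crd1 u| `^ alpha p).

Lemma lin_tauSigma (R : realType) (p : geo_params R) (u : R * R * R) :
  admissible p -> Ssec u -> crd1 u != 0 -> lin p (tauSigma p u) u = hitSigma p u.
Proof.
move=> hp [_ _ u3] u1.
have l1 : lambda1 p != 0.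
  by rewrite gt_eqF// (lt_trans (lambda3_gt0 hp) (lambda31 hp)).
have n0 : 0 < `|crd1 u| by rewrite normr_gt0.
have lnV' : ln (1 / `|crd1 u|) = - ln `|crd1 u| by rewrite div1r lnV// posrE.
rewrite /lin /hitSigma /tauSigma lnV' u3 mul1r mulrA mulfV// mul1r.
rewrite expRN lnK// /powR gt_eqF//; congr (_, _, _).
- by rewrite {1}[crd1 u]numEsg mulfK// gt_eqF.
- by congr (_ * expR _); rewrite /beta -mulrA mulrN mulrN opprK.
- by congr (expR _); rewrite /alpha -mulrA mulrN mulrN opprK.
Qed.

Definition radius (R : realType) (p : geo_params R) (w3 s : R) : R :=
  1 - w3 + (1 / 2 - (theta p - 1) * w3) * (s / (3 / 2 * pi)).

(* To be used for [crd1 w = 1] or [crd1 w = -1] only. *)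
Definition rot_phase (R : realType) (p : geo_params R) (s : R) (w : R * R * R)
    : R * R * R :=
  let r := radius p (crd3 w) s in
  if crd1 w == 1 then
    (1 + r * sin s, crd2 w - 1 / 4 * (s / (3 / 2 * pi)), 1 - r * cos s)
  else
    (-1 - r * sin s, crd2 w + 1 / 4 * (s / (3 / 2 * pi)), 1 - r * cos s).

Definition return_time (R : realType) (p : geo_params R) (u : R * R * R) : R :=
  tauSigma p u + 3 / 2 * pi.

Definition return_map (R : realType) (p : geo_params R) (u : R * R * R)
    : R * R * R :=
  rot_phase p (3 / 2 * pi) (hitSigma p u).

(* Times in [0, first return to S[, i.e. in [0, +oo[ if [u] is on Gamma. *)
Definition before_return (R : realType) (p : geo_params R) (u : R * R * R)
    : set R :=
  [set t | 0 <= t /\ (crd1 u != 0 -> t < return_time p u)].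

Definition geo_path (R : realType) (p : geo_params R) (u : R * R * R) (t : R)
    : R * R * R :=
  if (crd1 u == 0) || (t <= tauSigma p u) then lin p t u
  else rot_phase p (t - tauSigma p u) (hitSigma p u).

(* The return points need not be added: they are in [Ssec], hence are the
   starting points of other paths. *)
Definition Lambda (R : realType) (p : geo_params R) : set (R * R * R) :=
  [set v | exists u t, [/\ Ssec u, before_return p u t & geo_path p u t = v]].

(* For admissible parameters and [v] in [Lambda p] the point picked by [get] is
   unique: in the rotation phase the two branches can only meet for s > pi, and
   there crd2 < 0 on the branch w1 = 1 and crd2 > 0 on the branch w1 = -1, by the
   lower bound on beta; on one branch (s, w3) are read off the polar coordinates
   around (+-1, _, 1), as the radius is strictly decreasing in w3. *)
Definition origin (R : realType) (p : geo_params R) (v : R * R * R)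
    : R * R * R :=
  get [set u | Ssec u /\ exists2 t, before_return p u t & geo_path p u t = v].

Definition nth_return_time (R : realType) (p : geo_params R) (n : nat)
    (u : R * R * R) : R :=
  \sum_(i < n) return_time p (iter i (return_map p) u).

(* [w] is reached after time [t] from [v]: [v] is the point at time [s] of the
   path started from [u] in [Ssec], and time [s + t] on the concatenated path
   started from [u] falls after the [n]th return and before the next one. For
   [v] in [Lambda p] and [0 <= t] there is exactly one such [w]. *)
Definition geo_reach (R : realType) (p : geo_params R) (t : R)
    (v w : R * R * R) : Prop :=
  exists u s n,
    let un := iter n (return_map p) u in
    let tn := s + t - nth_return_time p n u in
    [/\ Ssec u /\ before_return p u s,
        geo_path p u s = v,
        forall i, (i < n)%N -> crd1 (iter i (return_map p) u) != 0,
        before_return p un tn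
      & geo_path p un tn = w].

Definition Psi (R : realType) (p : geo_params R) (t : R) (v : R * R * R)
    : R * R * R :=
  get [set w | geo_reach p t v w].

(* The value at 0, where the map is undefined, is immaterial: the measures
   considered below do not charge 0. *)
Definition fmap1 (R : realType) (p : geo_params R) (x : R) : R :=
  if 0 < x then theta p * `|x| `^ alpha p - 1 / 2
  else if x < 0 then - (theta p * `|x| `^ alpha p) + 1 / 2
  else 0.

Lemma crd1_return_map (R : realType) (p : geo_params R) (u : R * R * R) :
  crd1 u != 0 -> crd1 (return_map p u) = fmap1 p (crd1 u).
Proof.
have s1 : sin (3 / 2 * pi) = -1 :> R.
  have -> : 3 / 2 * pi = pi / 2 + pi :> R by field.
  by rewrite sinDpi sin_pihalf.
have pi0 : 3 / 2 * pi != 0 :> R by rewrite mulf_neq0// gt_eqF// ?pi_gt0.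
case: u => -[x y] z; rewrite /return_map /rot_phase /fmap1 /radius /hitSigma.
rewrite /crd1 /crd3 /= divff//; case: ltgtP => // x0 _.
  by rewrite gtr0_sg// eqxx /= s1; ring.
by rewrite ltr0_sg// lt_eqF ?s1 /=; [ring | lra].
Qed.

Record acip (R : realType) (p : geo_params R)
    (mu : probability (measurableTypeR R) R) : Prop := Acip {
  acip_supp : mu `[- (1 / 2), 1 / 2]%classic = 1%E;
  acip_invariant : forall A : set (measurableTypeR R), measurable A ->
    mu (fmap1 p @^-1` A) = mu A;
  acip_ac : mu `<< @lebesgue_measure R }.

Record is_mu_f (R : realType) (p : geo_params R)
    (mu : probability (measurableTypeR R) R) : Prop := IsMuF {
  mu_f_acip : acip p mu;
  mu_f_unique : forall nu : probability (measurableTypeR R) R, acip p nu ->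
    forall A, measurable A -> nu A = mu A;
  mu_f_ergodic : forall A : set (measurableTypeR R), measurable A ->
    mu (A `+` fmap1 p @^-1` A) = 0%E -> mu A = 0%E \/ mu A = 1%E;
  mu_f_bounded_density : exists (g : measurableTypeR R -> R) (M : R),
    [/\ measurable_fun setT g, forall x, 0 <= g x <= M
      & forall A, measurable A ->
          mu A = (\int[lebesgue_measure]_(x in A) (g x)%:E)%E] }.

Definition is_curve (R : realType) (A : set (R * R * R)) : Prop :=
  exists g : R -> R * R * R,
    {within `[0, 1], continuous g} /\ A = g @` `[0, 1].

(* Main.v *)
Require Import Defs.
From HB Require Import structures.
From mathcomp Require Import all_boot all_order all_algebra.
From mathcomp Require Import all_classical all_reals all_analysis.
From mathcomp Require Import measurable_realfun.
From mathcomp Require Import ring lra.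
Set Implicit Arguments.
Unset Strict Implicit.
Unset Printing Implicit Defensive.
Import Order.TTheory GRing.Theory Num.Theory.
Import numFieldNormedType.Exports.
Local Open Scope classical_set_scope.
Local Open Scope ring_scope.

(** In its first coordinate the return map to the section is the map
    [f = fmap1 p] of the interval.  It has two concave or convex power branches
    and expands distances by at least [theta * alpha > 1] on each of them
    ([fmap1_expand]).  Fix [u] and a return number [n], and pull a short interval
    starting at [y_n = f^n x] back along the inverse branches that the orbit of
    [x] follows.  The section points obtained in this way, with the second
    coordinate of the origin of [u], form a piece [leaf] of an unstable leaf;
    letting them run for the time that [u] has already spent since leaving the
    section gives the anti-leaf set.  The map from the end position [y] to the
    anti-leaf is Lipschitz, so the set is a curve and, by the intermediate value
    theorem, the distances to [u] at time [t_k] fill an interval.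

    Backwards in time the distances of the first coordinates decay like
    [kappa^(n - m)] with [kappa = 1 / (theta * alpha)].  Two things could spoil the
    estimate.  The pulled-back interval must not leave the branch, whose ends
    are [0] and [+-1/2].  And a return at distance [a] from [0] turns a distance
    [d] into a time lag of order [d / a], a lag that never disappears afterwards,
    and keeps the path busy for a time of order [ln (1/a)], hence for at most
    [const / (a h)] sampling times.  Both are harmless if the [m]-th return of [u]
    keeps a distance [c * q^(n - m)] from [0] and [+-1/2] for all [m <= n], where
    [q^4 = kappa]: this is the predicate [away].  Lags and distances during turn [m]
    are then [O(q^(3 (n - m)))] times the final displacement
    ([shadow_flow]), there are [O(q^(- (n - m)))] sampling times in that turn, and
    the total is a geometric series ([shadow_sum]).

    Almost every [x] is [away] for infinitely many [n] with one and the same [c]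
    ([ae_often_away]).  Indeed, for a fixed [n] the invariance of the measure and
    the bound on its density make the set of [x] that fail [away n c] of measure
    at most [K * c], uniformly in [n], because the widths [c * q^(n - m)] sum up;
    hence the set of [x] that fail it for all large [n] also has measure at
    most [K * c], and [c] is arbitrary.

    The distance at time [t_k] must also be bounded below by the displacement
    [y - y_n].  This is arranged by sampling in the linear phase that follows
    the [n]-th return, which is possible if [h] is at most a third of the shortest
    linear phase.  There a time lag could compensate a displacement of the first
    coordinate, but the third coordinate would then reveal the lag
    ([lin_separation]).  For all other [k] the anti-leaf set is [u] alone. *)

(** * Elementary inequalities *)

Section Elementary.
Variable R : realType.
Implicit Types a b x y z t : R.

(** Weighted sum of the two bounds [1 + x <= expR x] at [(1 - a) * L] and [- a * L],
    where [z = expR L]; the linear terms in [L] cancel. *)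
Lemma powR_bernoulli a z : 0 <= a -> a <= 1 -> 0 < z -> z `^ a <= 1 + a * (z - 1).
Proof.
move=> a0 a1 z0; rewrite /powR gt_eqF//; set L := ln z.
have zE : z = expR (a * L) * expR ((1 - a) * L).
  by rewrite -expRD -mulrDl addrC subrK mul1r lnK.
have oneE : 1 = expR (a * L) * expR (- (a * L)) by rewrite -expRD subrr expR0.
have h1 : expR (a * L) * (1 + (1 - a) * L) <= z.
  by rewrite [leRHS]zE ler_wpM2l ?expR_ge0 ?expR_ge1Dx.
have h2 : expR (a * L) * (1 + - (a * L)) <= 1.
  by rewrite [leRHS]oneE ler_wpM2l ?expR_ge0 ?expR_ge1Dx.
have := lerD (ler_wpM2l a0 h1) (ler_wpM2l (_ : 0 <= 1 - a) h2).
rewrite subr_ge0 => /(_ a1) h; lra.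
Qed.

(** [powR_bernoulli] for the exponent [1 / b], applied to [z `^ b]. *)
Lemma powR_bernoulli_ge1 b z : 1 <= b -> 0 < z -> 1 + b * (z - 1) <= z `^ b.
Proof.
move=> b1 z0; have b0 : 0 < b by lra.
have bV0 : 0 <= b^-1 by rewrite invr_ge0 ltW.
have bV1 : b^-1 <= 1 by rewrite invf_le1.
have := powR_bernoulli bV0 bV1 (powR_gt0 b z0).
rewrite -powRrM mulfV ?gt_eqF// powRr1 ?(ltW z0)// => h.
have := ler_wpM2l (ltW b0) h.
rewrite mulrDr mulrA mulfV ?gt_eqF//; lra.
Qed.

Lemma powR_scale a x y : 0 < x -> 0 < y -> y `^ a = x `^ a * (y / x) `^ a.
Proof.
move=> x0 y0; rewrite -powRM ?ltW ?divr_gt0//.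
by rewrite mulrCA mulfV ?gt_eqF// mulr1.
Qed.

(** Concave powers expand on [[0, 1]]: this is what makes [fmap1] expanding. *)
Lemma powR_expand a x y : 0 <= a -> a <= 1 -> 0 < x -> x <= y -> y <= 1 ->
  a * (y - x) <= y `^ a - x `^ a.
Proof.
move=> a0 a1 x0 xy y1; have y0 : 0 < y by lra.
have yy : y <= y `^ a by apply: ger1_powR => //; rewrite y0.
rewrite (@powR_scale a y x)//.
have h := @powR_bernoulli a (x / y) a0 a1 (divr_gt0 x0 y0).
have s1 : 0 <= 1 - x / y by rewrite subr_ge0 ler_pdivrMr// mul1r.
have -> : y - x = y * (1 - x / y) by field; rewrite gt_eqF.
have h1 : y * (a * (1 - x / y)) <= y `^ a * (a * (1 - x / y)).
  by rewrite ler_wpM2r// mulr_ge0.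
have h2 : y `^ a * (x / y) `^ a <= y `^ a * (1 + a * (x / y - 1)).
  by rewrite ler_wpM2l// powR_ge0.
lra.
Qed.

Lemma powR_lip b x y : 1 <= b -> 0 < x -> 0 < y -> x <= 1 -> y <= 1 ->
  `|y `^ b - x `^ b| <= b * `|y - x|.
Proof.
wlog xy : x y / x <= y => [hw|] b1 x0 y0 x1 y1.
  have [xy|/ltW yx] := leP x y; first exact: hw.
  by rewrite distrC [`|y - x|]distrC hw.
have yy : y `^ b <= y by apply: ge1r_powR => //; rewrite y0.
rewrite !ger0_norm ?subr_ge0//; last first.
  by rewrite ge0_ler_powR// ?nnegrE; lra.
rewrite (@powR_scale b y x)//.
have h := @powR_bernoulli_ge1 b (x / y) b1 (divr_gt0 x0 y0).
have s1 : 0 <= 1 - x / y by rewrite subr_ge0 ler_pdivrMr// mul1r.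
have -> : y - x = y * (1 - x / y) by field; rewrite gt_eqF.
have h1 : y `^ b * (b * (1 - x / y)) <= y * (b * (1 - x / y)).
  by rewrite ler_wpM2r// mulr_ge0//; lra.
have h2 : y `^ b * (1 + b * (x / y - 1)) <= y `^ b * (x / y) `^ b.
  by rewrite ler_wpM2l// powR_ge0.
lra.
Qed.

Lemma expR_lip M x y : x <= M -> y <= M ->
  `|expR x - expR y| <= expR M * `|x - y|.
Proof.
wlog yx : x y / y <= x => [hw|] xM yM.
  have [yx|/ltW xy] := leP y x; first exact: hw.
  by rewrite distrC [`|x - y|]distrC hw.
rewrite !ger0_norm ?subr_ge0 ?ler_expR//.
have -> : expR y = expR x * expR (y - x) by rewrite -expRD addrC subrK.
have h1 : expR x * (1 + (y - x)) <= expR x * expR (y - x).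
  by rewrite ler_wpM2l ?expR_ge0 ?expR_ge1Dx.
have h2 : expR x * (x - y) <= expR M * (x - y).
  by rewrite ler_wpM2r ?ler_expR// subr_ge0.
lra.
Qed.

Lemma expR_colip m x y : m <= x -> m <= y ->
  expR m * `|x - y| <= `|expR x - expR y|.
Proof.
wlog yx : x y / y <= x => [hw|] mx my.
  have [yx|/ltW xy] := leP y x; first exact: hw.
  by rewrite distrC [leRHS]distrC hw.
rewrite !ger0_norm ?subr_ge0 ?ler_expR//.
have -> : expR x = expR y * expR (x - y) by rewrite -expRD addrC subrK.
have h1 : expR y * (1 + (x - y)) <= expR y * expR (x - y).
  by rewrite ler_wpM2l ?expR_ge0 ?expR_ge1Dx.
have h2 : expR m * (x - y) <= expR y * (x - y).
  by rewrite ler_wpM2r ?ler_expR// subr_ge0.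
lra.
Qed.

Lemma ln_lip b x y : 0 < b -> b <= x -> b <= y -> `|ln x - ln y| <= `|x - y| / b.
Proof.
wlog yx : x y / y <= x => [hw|] b0 bx yb.
  have [yx|/ltW xy] := leP y x; first exact: hw.
  by rewrite distrC [`|x - y|]distrC hw.
have y0 : 0 < y by lra.
have x0 : 0 < x by lra.
rewrite !ger0_norm ?subr_ge0 ?ler_ln ?posrE//.
rewrite -ln_div ?posrE//.
have /le_ln1Dx : -1 < x / y - 1 by have := divr_gt0 x0 y0; lra.
rewrite addrC subrK => /le_trans; apply.
have -> : x / y - 1 = (x - y) / y by field; rewrite gt_eqF.
by rewrite ler_wpM2l ?subr_ge0// lef_pV2 ?posrE.
Qed.

Lemma MVT_lip (f df : R -> R) x y : (forall z, is_derive z 1 f (df z)) ->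
  (forall z, `|df z| <= 1) -> `|f x - f y| <= `|x - y|.
Proof.
move=> fd d1; wlog yx : x y / y <= x => [hw|].
  have [yx|/ltW xy] := leP y x; first exact: hw.
  by rewrite distrC [`|x - y|]distrC hw.
have fc : {within `[y, x], continuous f}.
  apply: continuous_subspaceT => z.
  by apply/differentiable_continuous/derivable1_diffP; have [] := fd z.
have [c _ ->] := MVT_segment yx (fun z _ => fd z) fc.
by rewrite normrM ler_piMl.
Qed.

Lemma sin_lip x y : `|sin x - sin y| <= `|x - y|.
Proof. by apply: (@MVT_lip sin cos) => z; exact: cos_max. Qed.

Lemma cos_lip x y : `|cos x - cos y| <= `|x - y|.
Proof.
by apply: (@MVT_lip cos (fun z => - sin z)) => z; rewrite normrN; exact: sin_max.
Qed.

(** A point of the circle determines its angle; used to read the time of the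
    rotation phase off the polar coordinates. *)
Lemma sin_cos_inj x y : 0 <= x -> x < 2 * pi -> 0 <= y -> y < 2 * pi ->
  sin x = sin y -> cos x = cos y -> x = y.
Proof.
move=> x0 x2 y0 y2 sxy cxy.
have sN z : pi < z -> z < 2 * pi -> sin z < 0.
  move=> z1 z2; have -> : z = (z - pi) + pi by ring.
  by rewrite sinDpi oppr_lt0 sin_gt0_pi//; lra.
have sP z : 0 <= z -> z <= pi -> 0 <= sin z.
  by move=> z1 z2; rewrite sin_ge0_pi// z1.
have [xp|xp] := leP x pi; have [yp|yp] := leP y pi.
- by apply: cos_inj => //; rewrite in_itv/= ?x0 ?y0.
- by have := sP _ x0 xp; rewrite sxy leNgt sN.
- by have := sP _ y0 yp; rewrite -sxy leNgt sN.
- apply: (@addIr _ (- pi)); apply: cos_inj.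
  + by rewrite in_itv/=; lra.
  + by rewrite in_itv/=; lra.
  + have e z : cos (z - pi) = - cos z by rewrite cosB cospi sinpi; ring.
    by rewrite !e cxy.
Qed.

(** Products of bounded Lipschitz functions are Lipschitz. *)
Lemma distM a b x y : `|a * x - b * y| <= `|a| * `|x - y| + `|y| * `|a - b|.
Proof.
have -> : a * x - b * y = a * (x - y) + y * (a - b) by ring.
by rewrite (le_trans (ler_normD _ _))// !normrM.
Qed.

Lemma minr_lip c x y : `|Num.min x c - Num.min y c| <= `|x - y|.
Proof.
wlog xy : x y / x <= y => [hw|].
  have [xy|/ltW yx] := leP x y; first exact: hw.
  by rewrite distrC [leRHS]distrC hw.
rewrite [leRHS]ler0_norm ?subr_le0//.
by have [h|h] := leP x c; have [h'|h'] := leP y c;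
  rewrite ler_norml; lra.
Qed.

Lemma maxr_lip c x y : `|Num.max x c - Num.max y c| <= `|x - y|.
Proof.
wlog xy : x y / x <= y => [hw|].
  have [xy|/ltW yx] := leP x y; first exact: hw.
  by rewrite distrC [leRHS]distrC hw.
rewrite [leRHS]ler0_norm ?subr_le0//.
by have [h|h] := leP x c; have [h'|h'] := leP y c;
  rewrite ler_norml; lra.
Qed.

Lemma minr_lip2 a b x y : `|Num.min a x - Num.min b y| <= `|a - b| + `|x - y|.
Proof.
have -> : Num.min a x - Num.min b y =
  (Num.min a x - Num.min b x) + (Num.min x b - Num.min y b).
  by rewrite ![Num.min b _]minC; ring.
by rewrite (le_trans (ler_normD _ _))// lerD// minr_lip.
Qed.

Lemma norm3_le (u : R * R * R) M : `|crd1 u| <= M -> `|crd2 u| <= M ->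
  `|crd3 u| <= M -> `|u| <= M.
Proof. by move=> *; rewrite !prod_normE !ge_max; apply/andP; split => //; apply/andP. Qed.

Lemma norm3_ge1 (u : R * R * R) : `|crd1 u| <= `|u|.
Proof. by rewrite !prod_normE !le_max lexx. Qed.

Lemma norm3_ge3 (u : R * R * R) : `|crd3 u| <= `|u|.
Proof. by rewrite !prod_normE !le_max lexx !orbT. Qed.

End Elementary.

(** * The turns of the path between two returns *)

Section Params.
Variables (R : realType) (p : geo_params R).
Hypothesis hp : admissible p.

Lemma lambda1_gt0 : 0 < lambda1 p.
Proof. exact: lt_trans (lambda3_gt0 hp) (lambda31 hp). Qed.

Lemma lambda2_gt0 : 0 < lambda2 p.
Proof. exact: lt_trans lambda1_gt0 (lambda12 hp). Qed.

Lemma alpha_gt_half : 1 / 2 < alpha p.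
Proof.
apply: le_lt_trans (alpha_gt hp); rewrite !div1r lef_pV2 ?posrE ?sqrtr_gt0//.
have := sqr_sqrtr (ler0n R 2); have := sqrtr_ge0 (2 : R); nra.
Qed.

Lemma alpha_gt0 : 0 < alpha p.
Proof. by have := alpha_gt_half; lra. Qed.

Lemma beta_gt1 : 1 < beta p.
Proof. by rewrite /beta ltr_pdivlMr ?mul1r ?lambda1_gt0// (lambda12 hp). Qed.

(** This is the form in which the lower bound on [beta] enters: the second
    coordinate of a path that reaches the planes [u_1 = +-1] is below [1 / 6] in
    absolute value, so that the two rotating branches cannot meet. *)
Lemma half_powR_beta : (1 / 2) `^ beta p < 1 / 3.
Proof.
have l2 : 0 < ln 2 :> R by rewrite ln_gt0//; lra.
have := beta_gt hp; rewrite ltrBlDr ltr_pdivrMr// => h.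
rewrite /powR ifF; last by apply/eqP; lra.
rewrite -[ltRHS]lnK ?posrE ?ltr_expR; last by lra.
rewrite !div1r !lnV ?posrE//.
have e6 : (6 : R) = 2 * 3 by ring.
move: h; rewrite e6 lnM ?posrE//; lra.
Qed.

Lemma sqrt2_le_pow2alpha : Num.sqrt 2 <= 2 `^ alpha p.
Proof.
rewrite -[Num.sqrt 2]powR12_sqrt// ler_powR//; first by lra.
by have := alpha_gt_half; rewrite div1r => /ltW.
Qed.

Lemma theta_alpha_gt1 : 1 < theta p * alpha p.
Proof.
have s2 : 0 < Num.sqrt 2 :> R by rewrite sqrtr_gt0.
have a0 := alpha_gt0.
have := theta_gt hp; rewrite ltr_pdivrMr; last exact: mulr_gt0.
move=> h; have h2 := sqrt2_le_pow2alpha.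
have : Num.sqrt 2 * 1 < Num.sqrt 2 * (theta p * alpha p).
  by rewrite mulr1 mulrCA; apply: le_lt_trans h2 h.
by rewrite ltr_pM2l.
Qed.

Lemma theta_gt1 : 1 < theta p.
Proof.
have a0 := alpha_gt0; have a1 := alpha_lt1 hp; have := theta_alpha_gt1; nra.
Qed.

Lemma theta_lt2 : theta p < 2.
Proof.
apply: lt_le_trans (theta_lt hp) _.
rewrite -[leRHS]powRr1// ler_powR ?(ltW (alpha_lt1 hp))//; lra.
Qed.

Lemma theta_half_alpha : theta p * (1 / 2) `^ alpha p < 1.
Proof.
have e : 2 `^ alpha p * (1 / 2) `^ alpha p = 1 :> R.
  by rewrite -powRM// ?divr_ge0// mulrCA mulfV ?mulr1 ?powR1.
by rewrite -[ltRHS]e ltr_pM2r ?(theta_lt hp)// powR_gt0; lra.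
Qed.

(** The rotation phase, started at a point with first coordinate [sg * A]
    instead of [sg]; for [e = 0] it is the point [(sg * A, w2, w3)] itself. *)
Definition spiral (sg A w2 w3 e : R) : R * R * R :=
  (sg * (A + Defs.radius p w3 e * sin e), w2 - sg * (1 / 4 * (e / (3 / 2 * pi))),
   1 - Defs.radius p w3 e * cos e).

(** One path from the section to its next return, both phases in a single
    formula: [m] is the time spent in the linear phase, and the last argument the
    time spent rotating.  After its return the path stays where it is,
    which makes it Lipschitz on the whole half-line. *)
Definition turn (u : R * R * R) (t : R) : R * R * R :=
  let tau := tauSigma p u in
  let m := Num.min t tau in
  spiral (Num.sg (crd1 u)) (expR (lambda1 p * (m - tau)))
    (crd2 u * expR (- (lambda2 p * m))) (expR (- (lambda3 p * m)))
    (Num.min t (return_time p u) - m).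

Lemma rot_time_ge1 : 1 <= 3 / 2 * pi :> R.
Proof. by have := pi_ge2 R; lra. Qed.

Lemma tauSigmaE u : crd1 u != 0 -> tauSigma p u = - ln `|crd1 u| / lambda1 p.
Proof. by move=> u0; rewrite /tauSigma div1r lnV ?posrE ?normr_gt0// mulrC. Qed.

(** Written in this way the first coordinate of a linear path is the
    exponential of a nonpositive number, whose Lipschitz constant does not depend
    on how close the path starts to [u_1 = 0]. *)
Lemma norm_crd1_expR u : crd1 u != 0 -> `|crd1 u| = expR (- (lambda1 p * tauSigma p u)).
Proof.
move=> u0; rewrite tauSigmaE// mulrCA mulfV ?gt_eqF ?lambda1_gt0// mulr1 opprK.
by rewrite lnK// posrE normr_gt0.
Qed.

Lemma lambda1_tauSigma u : Ssec u -> crd1 u != 0 -> ln 2 <= lambda1 p * tauSigma p u.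
Proof.
move=> [u1 _ _] u0; rewrite -ler_expR lnK ?posrE//.
rewrite -[leRHS]invrK -expRN -norm_crd1_expR//.
by rewrite -[leLHS]invrK lef_pV2 ?posrE ?invr_gt0 ?normr_gt0// -div1r.
Qed.

Lemma tauSigma_gt0 u : Ssec u -> crd1 u != 0 -> 0 < tauSigma p u.
Proof.
move=> uS u0; rewrite -(pmulr_rgt0 _ lambda1_gt0).
by apply: lt_le_trans (lambda1_tauSigma uS u0); rewrite ln_gt0//; lra.
Qed.

Lemma return_time_ge1 u : Ssec u -> crd1 u != 0 -> 1 <= return_time p u.
Proof.
move=> uS u0; rewrite /return_time.
by have := tauSigma_gt0 uS u0; have := rot_time_ge1; lra.
Qed.

Lemma rot_phase_spiral (s : R) (u : R * R * R) : crd1 u != 0 ->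
  rot_phase p s (hitSigma p u) =
  spiral (Num.sg (crd1 u)) 1 (crd2 u * `|crd1 u| `^ beta p) (`|crd1 u| `^ alpha p) s.
Proof.
case: u => -[x y] z; rewrite /rot_phase /hitSigma /spiral /crd1 /crd2 /crd3 /=.
case: sgrP => // u1 _; first by rewrite eqxx !mul1r.
rewrite lt_eqF; last by lra.
by congr (_, _, _); ring.
Qed.

Lemma expR_tau u (l : R) : crd1 u != 0 ->
  expR (- (l * tauSigma p u)) = `|crd1 u| `^ (l / lambda1 p).
Proof.
move=> u0; rewrite /powR normr_eq0 (negPf u0) tauSigmaE//.
by congr expR; ring.
Qed.

Lemma turn_lin u (t : R) : Ssec u -> crd1 u != 0 -> t <= tauSigma p u ->
  turn u t = lin p t u.
Proof.
move=> [_ _ u3] u0 tt; have r0 := rot_time_ge1.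
rewrite /turn /lin /return_time !min_l//; last by lra.
rewrite subrr /spiral sin0 cos0 mulr0 addr0 mul0r !mulr0 subr0 mulr1.
rewrite /Defs.radius mul0r mulr0 addr0 u3 mul1r; congr (_, _, _).
  rewrite [in RHS](numEsg (crd1 u)) norm_crd1_expR// -mulrA -expRD.
  by congr (_ * expR _); ring.
by rewrite subKr.
Qed.

Lemma turn_rot u (t : R) : crd1 u != 0 -> tauSigma p u <= t ->
  t <= return_time p u ->
  turn u t = rot_phase p (t - tauSigma p u) (hitSigma p u).
Proof.
move=> u0 t1 t2; rewrite rot_phase_spiral// /turn (min_l t2) (min_r t1).
by rewrite subrr mulr0 expR0 !expR_tau.
Qed.

Lemma geo_path_turn u (t : R) : Ssec u -> crd1 u != 0 -> t <= return_time p u ->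
  geo_path p u t = turn u t.
Proof.
move=> uS u0 t2; rewrite /geo_path (negPf u0) /=.
by case: leP => [t1|/ltW t1]; [rewrite turn_lin | rewrite turn_rot].
Qed.

Lemma turn_return u (t : R) : crd1 u != 0 -> return_time p u <= t ->
  turn u t = return_map p u.
Proof.
move=> u0 h; have r0 := rot_time_ge1.
have -> : turn u t = turn u (return_time p u).
  rewrite /turn (min_r h) minxx !min_r//; move: h; rewrite /return_time; lra.
rewrite turn_rot//; last by rewrite /return_time; lra.
by rewrite /return_map /return_time addrC addKr.
Qed.

Lemma turn0 u : Ssec u -> crd1 u != 0 -> turn u 0 = u.
Proof.
move=> uS u0; rewrite turn_lin ?(ltW (tauSigma_gt0 _ _))//.
by rewrite /lin !mulr0 oppr0 expR0 !mulr1; case: u {uS u0} => -[].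
Qed.

Lemma radius_norm (w e : R) : 0 <= w -> w <= 1 -> 0 <= e -> e <= 3 / 2 * pi ->
  `|Defs.radius p w e| <= 2.
Proof.
move=> w0 w1 e0 e1; rewrite /Defs.radius; have r1 := rot_time_ge1.
have s0 : 0 <= e / (3 / 2 * pi) by rewrite divr_ge0//; lra.
have s1 : e / (3 / 2 * pi) <= 1 by rewrite ler_pdivrMr; lra.
have t1 := theta_gt1; have t2 := theta_lt2.
move: (e / _) s0 s1 => s s0 s1.
have ws0 : 0 <= w * s by rewrite mulr_ge0.
have ws1 : w * s <= 1 by rewrite mulr_ile1.
have tws0 : 0 <= (theta p - 1) * (w * s) by rewrite mulr_ge0//; lra.
have tws1 : (theta p - 1) * (w * s) <= 1 by rewrite mulr_ile1//; lra.
by rewrite ler_norml; apply/andP; split; lra.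
Qed.

Lemma radius_lip (w e w' e' : R) : 0 <= w -> w <= 1 -> 0 <= w' -> w' <= 1 ->
  0 <= e -> e <= 3 / 2 * pi ->
  `|Defs.radius p w e - Defs.radius p w' e'| <= 2 * `|w - w'| + `|e - e'|.
Proof.
move=> w0 w1 w'0 w'1 e0 e1; rewrite /Defs.radius; have r1 := rot_time_ge1.
have s0 : 0 <= e / (3 / 2 * pi) by rewrite divr_ge0//; lra.
have s1 : e / (3 / 2 * pi) <= 1 by rewrite ler_pdivrMr; lra.
have se : `|e / (3 / 2 * pi) - e' / (3 / 2 * pi)| <= `|e - e'|.
  by rewrite -mulrBl normrM ler_piMr// normfV invf_le1 ger0_norm; lra.
have t1 := theta_gt1; have t2 := theta_lt2.
move: (e / _) (e' / _) s0 s1 se => s s' s0 s1 se.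
have -> : 1 - w + (1 / 2 - (theta p - 1) * w) * s -
   (1 - w' + (1 / 2 - (theta p - 1) * w') * s') =
   - (1 + (theta p - 1) * s) * (w - w') +
   (1 / 2 - (theta p - 1) * w') * (s - s') by ring.
rewrite (le_trans (ler_normD _ _))// !normrM; apply: lerD.
  rewrite ler_wpM2r// normrN ger0_norm; nra.
rewrite -[leRHS]mul1r ler_pM//.
by rewrite ler_norml; apply/andP; split; nra.
Qed.

(** All arguments are bounded, so each coordinate is a product of bounded
    Lipschitz functions. *)
Lemma spiral_lip (sg A w2 w3 e A' w2' w3' e' : R) : `|sg| <= 1 ->
  0 <= w3 -> w3 <= 1 -> 0 <= w3' -> w3' <= 1 -> 0 <= e -> e <= 3 / 2 * pi ->
  `|spiral sg A w2 w3 e - spiral sg A' w2' w3' e'| <=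
  `|A - A'| + `|w2 - w2'| + 2 * `|w3 - w3'| + 3 * `|e - e'|.
Proof.
move=> sg1 w0 w1 w'0 w'1 e0 e1; have r1 := rot_time_ge1.
have hr := radius_norm w0 w1 e0 e1.
have hd := radius_lip e' w0 w1 w'0 w'1 e0 e1.
have := normr_ge0 (A - A'); have := normr_ge0 (w2 - w2').
have := normr_ge0 (w3 - w3'); have := normr_ge0 (e - e').
move=> ge gw3 gw2 gA.
have hsc (f : R -> R) : (forall x, `|f x| <= 1) ->
    (forall x y, `|f x - f y| <= `|x - y|) ->
  `|Defs.radius p w3 e * f e - Defs.radius p w3' e' * f e'| <=
  2 * `|w3 - w3'| + 3 * `|e - e'|.
  move=> f1 fl; rewrite (le_trans (distM _ _ _ _))//.
  have := ler_pM (normr_ge0 _) (normr_ge0 _) hr (fl e e').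
  have := ler_pM (normr_ge0 _) (normr_ge0 _) (f1 e') hd.
  lra.
apply: norm3_le; rewrite /spiral /crd1 /crd2 /crd3 /=.
- rewrite -mulrBr normrM; apply: (le_trans (ler_piMl _ sg1)) => //.
  rewrite opprD addrACA (le_trans (ler_normD _ _))//.
  have := hsc sin (@sin_max R) (@sin_lip R); lra.
- rewrite opprD addrACA (le_trans (ler_normD _ _))//.
  rewrite -opprD normrN -!mulrBr -mulrBl normrM [`|1 / 4 * _|]normrM.
  rewrite [`|(e - e') * _|]normrM.
  have i1 : `|(3 / 2 * pi : R)^-1| <= 1.
    by rewrite normfV invf_le1 ger0_norm; lra.
  have i2 : `|1 / 4 : R| <= 1 by rewrite ger0_norm; lra.
  have h1 : `|e - e'| * `|(3 / 2 * pi)^-1| <= `|e - e'| by rewrite ler_piMr.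
  have h2 : `|1 / 4| * (`|e - e'| * `|(3 / 2 * pi)^-1|) <= `|e - e'|.
    by rewrite (le_trans _ h1)// ler_piMl// mulr_ge0.
  have h3 : `|sg| * (`|1 / 4| * (`|e - e'| * `|(3 / 2 * pi)^-1|)) <= `|e - e'|.
    by rewrite (le_trans _ h2)// ler_piMl// !mulr_ge0.
  lra.
- rewrite opprD addrACA subrr add0r -opprD normrN.
  have := hsc cos (@cos_max R) (@cos_lip R); lra.
Qed.

Definition turnC : R := 2 * lambda1 p + lambda2 p + 2 * lambda3 p + 6.

Lemma turnC_gt0 : 0 < turnC.
Proof.
by have := lambda1_gt0; have := lambda2_gt0; have := lambda3_gt0 hp;
  rewrite /turnC; lra.
Qed.

(** The starting point only matters through the time spent in the linear phase
    and the second coordinate. *)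
Lemma turn_lip u u' (t t' : R) : Ssec u -> Ssec u' -> crd1 u != 0 -> crd1 u' != 0 ->
  Num.sg (crd1 u) = Num.sg (crd1 u') -> 0 <= t -> 0 <= t' ->
  `|turn u t - turn u' t'| <=
  turnC * (`|t - t'| + `|tauSigma p u - tauSigma p u'|) + `|crd2 u - crd2 u'|.
Proof.
move=> uS u'S u0 u'0 usg t0 t'0; have r1 := rot_time_ge1.
have T := tauSigma_gt0 uS u0; have T' := tauSigma_gt0 u'S u'0.
rewrite /turn -usg.
have hm := minr_lip2 t t' (tauSigma p u) (tauSigma p u').
have he := minr_lip2 t t' (return_time p u) (return_time p u').
have erE : return_time p u - return_time p u' = tauSigma p u - tauSigma p u'.
  by rewrite /return_time; ring.
rewrite erE in he.
set D := `|t - t'| + _ in hm he *.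
have hDt : `|tauSigma p u - tauSigma p u'| <= D by rewrite lerDr.
set m := Num.min t _ in hm *; set m' := Num.min t' _ in hm *.
have m0 : 0 <= m by rewrite le_min t0 ltW.
have m'0 : 0 <= m' by rewrite le_min t'0 ltW.
have mt : m <= tauSigma p u by rewrite ge_min lexx orbT.
have m't : m' <= tauSigma p u' by rewrite ge_min lexx orbT.
have l1 := lambda1_gt0; have l2 := lambda2_gt0; have l3 := lambda3_gt0 hp.
have exp1 (l x : R) : 0 < l -> 0 <= x -> expR (- (l * x)) <= 1.
  by move=> l0 x0; rewrite -expR0 ler_expR oppr_le0 mulr_ge0// ltW.
have expl (x y : R) : x <= 0 -> y <= 0 -> `|expR x - expR y| <= `|x - y|.
  by move=> x0 y0; have := expR_lip x0 y0; rewrite expR0 mul1r.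
have explm (l : R) : 0 < l -> `|expR (- (l * m)) - expR (- (l * m'))| <= l * D.
  move=> l0; have l0' := ltW l0.
  rewrite (le_trans (expl _ _ _ _)) ?oppr_le0 ?mulr_ge0//.
  rewrite -opprD normrN -mulrBr normrM gtr0_norm// ler_wpM2l//.
have e0 : 0 <= Num.min t (return_time p u) - m.
  rewrite subr_ge0 le_min ge_min lexx /= ge_min /return_time.
  by apply/orP; right; lra.
have e1 : Num.min t (return_time p u) - m <= 3 / 2 * pi.
  rewrite /m /return_time.
  by have [h|h] := leP t (tauSigma p u);
    have [h'|h'] := leP t (tauSigma p u + 3 / 2 * pi); lra.
apply: (le_trans (spiral_lip _ _ _ _ _ _ _ _ _ _ e0 e1));
  rewrite ?expR_ge0 ?exp1//; first by rewrite normr_sg; case: (_ != _).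
have h3 := explm _ l3.
have h1 : `|expR (lambda1 p * (m - tauSigma p u)) -
            expR (lambda1 p * (m' - tauSigma p u'))| <= lambda1 p * (2 * D).
  rewrite (le_trans (expl _ _ _ _)) ?pmulr_rle0 ?subr_le0//.
  rewrite -mulrBr normrM gtr0_norm// ler_wpM2l ?(ltW l1)//.
  have -> : m - tauSigma p u - (m' - tauSigma p u') =
    (m - m') - (tauSigma p u - tauSigma p u') by ring.
  by rewrite (le_trans (ler_normB _ _))//; lra.
have h2 : `|crd2 u * expR (- (lambda2 p * m)) -
            crd2 u' * expR (- (lambda2 p * m'))| <=
    lambda2 p * D + `|crd2 u - crd2 u'|.
  rewrite (le_trans (distM _ _ _ _))// lerD//.
    have c2 : `|crd2 u| <= 1 by case: uS => _ ? _; lra.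
    rewrite (le_trans _ (explm _ l2))// ler_piMl//.
  by rewrite ler_piMl// ger0_norm ?expR_ge0// exp1.
have he' : `|Num.min t (return_time p u) - m -
             (Num.min t' (return_time p u') - m')| <= 2 * D.
  have -> : Num.min t (return_time p u) - m -
      (Num.min t' (return_time p u') - m') =
    (Num.min t (return_time p u) - Num.min t' (return_time p u')) - (m - m').
    by ring.
  by rewrite (le_trans (ler_normB _ _))//; lra.
rewrite /turnC; lra.
Qed.

(** The logarithm makes close passages of [u_1 = 0] the only source of large
    time lags. *)
Lemma tauSigma_lip (b : R) u u' : 0 < b -> b <= `|crd1 u| -> b <= `|crd1 u'| ->
  `|tauSigma p u - tauSigma p u'| <= `|crd1 u - crd1 u'| / b / lambda1 p.
Proof.
move=> b0 bu bu'; have l1 := lambda1_gt0.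
have u0 : crd1 u != 0 by rewrite -normr_gt0; lra.
have u'0 : crd1 u' != 0 by rewrite -normr_gt0; lra.
rewrite !tauSigmaE// -mulrBl normrM normfV (gtr0_norm l1).
rewrite ler_wpM2r ?invr_ge0 ?(ltW l1)//.
rewrite -opprD normrN (le_trans (ln_lip b0 _ _))//.
by rewrite ler_wpM2r ?invr_ge0 ?(ltW b0)// ler_dist_dist.
Qed.

End Params.

(** * The semigroup along an orbit of the return map *)

Section Semigroup.
Variables (R : realType) (p : geo_params R).
Hypothesis hp : admissible p.
Implicit Types (u v : R * R * R).

Lemma theta_powR_lt1 (x : R) : `|x| <= 1 / 2 -> theta p * `|x| `^ alpha p < 1.
Proof.
move=> x2; apply: le_lt_trans (theta_half_alpha hp).
have t1 := theta_gt1 hp; have a0 := alpha_gt0 hp.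
by rewrite ler_pM2l ?ge0_ler_powR ?nnegrE ?(ltW a0)//; lra.
Qed.

Lemma powR_alpha_lt1 (x : R) : `|x| <= 1 / 2 -> `|x| `^ alpha p < 1.
Proof.
move=> /theta_powR_lt1; have t1 := theta_gt1 hp.
by have := powR_ge0 `|x| (alpha p); nra.
Qed.

Lemma powR_beta_lt (x : R) : `|x| <= 1 / 2 -> `|x| `^ beta p < 1 / 3.
Proof.
move=> x2; apply: le_lt_trans (half_powR_beta hp).
by have b1 := beta_gt1 hp; rewrite ge0_ler_powR ?nnegrE//; lra.
Qed.

Lemma fmap1_bound (x : R) : `|x| <= 1 / 2 -> `|fmap1 p x| <= 1 / 2.
Proof.
move=> x2; have := theta_powR_lt1 x2; have t1 := theta_gt1 hp.
have : 0 <= theta p * `|x| `^ alpha p by rewrite mulr_ge0 ?powR_ge0//; lra.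
rewrite /fmap1 => h0 h1.
by case: ifP => _; [|case: ifP => _]; rewrite ler_norml; lra.
Qed.

Lemma cos32pi : cos (3 / 2 * pi) = 0 :> R.
Proof.
have -> : 3 / 2 * pi = pi / 2 + pi :> R by field.
by rewrite cosDpi cos_pihalf oppr0.
Qed.

Lemma crd2_return_map u : crd1 u != 0 ->
  crd2 (return_map p u) =
  crd2 u * `|crd1 u| `^ beta p - Num.sg (crd1 u) * (1 / 4).
Proof.
move=> u0; rewrite /return_map rot_phase_spiral// /spiral {1}/crd2 /= divff ?mulr1//.
by rewrite gt_eqF// mulr_gt0 ?pi_gt0//; lra.
Qed.

Lemma crd3_return_map u : crd1 u != 0 -> crd3 (return_map p u) = 1.
Proof.
by move=> u0; rewrite /return_map rot_phase_spiral// /spiral {1}/crd3 /= cos32pi mulr0 subr0.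
Qed.

(** The contraction [|u_1|^beta < 1 / 3] leaves room for the shift by [1 / 4]. *)
Lemma return_map_Ssec u : Ssec u -> crd1 u != 0 -> Ssec (return_map p u).
Proof.
move=> [u1 u2 u3] u0; split; last exact: crd3_return_map.
  by rewrite crd1_return_map// fmap1_bound.
have sg4 : `|Num.sg (crd1 u) * (1 / 4)| = 1 / 4.
  by rewrite normrM normr_sg u0 ger0_norm /=; lra.
rewrite crd2_return_map// (le_trans (ler_normB _ _))// sg4 normrM.
have := powR_beta_lt u1; have := powR_ge0 `|crd1 u| (beta p).
rewrite [`|_ `^ _|]ger0_norm ?powR_ge0//.
move: (_ `^ _) => b b0 b1; have := normr_ge0 (crd2 u); nra.
Qed.

(** The radius interpolates between [1 - w] and [3 / 2 - theta * w], both of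
    which are positive. *)
Lemma radius_bounds (w e : R) : 0 <= w -> w < 1 -> theta p * w < 1 ->
  0 <= e -> e <= 3 / 2 * pi -> 0 < Defs.radius p w e /\ Defs.radius p w e <= 3 / 2.
Proof.
move=> w0 w1 tw e0 e1; rewrite /Defs.radius; have r1 := rot_time_ge1 R.
have s0 : 0 <= e / (3 / 2 * pi) by rewrite divr_ge0//; lra.
have s1 : e / (3 / 2 * pi) <= 1 by rewrite ler_pdivrMr; lra.
have t1 := theta_gt1 hp.
move: (e / _) s0 s1 => s s0 s1.
have h1 : 0 <= (theta p - 1) * (w * s) by rewrite !mulr_ge0//; lra.
have h2 : 0 <= (1 - w) * (1 - s) by rewrite mulr_ge0//; lra.
have h3 : 0 <= (1 - theta p * w) * s by rewrite mulr_ge0//; lra.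
have h4 : 0 <= w * (1 - s) by rewrite mulr_ge0//; lra.
split; last by lra.
have [s2|s2] := leP s (1 / 2); last by lra.
have h5 : 0 < (1 - w) * (1 - s) by rewrite mulr_gt0//; lra.
lra.
Qed.

Lemma geo_path_cases u (s : R) : Ssec u -> before_return p u s ->
  [/\ geo_path p u s = lin p s u, `|crd1 (lin p s u)| <= 1 &
      crd3 (lin p s u) <= 1] \/
  [/\ crd1 u != 0, 0 < s - tauSigma p u, s - tauSigma p u < 3 / 2 * pi &
   geo_path p u s = spiral p (Num.sg (crd1 u)) 1 (crd2 u * `|crd1 u| `^ beta p)
        (`|crd1 u| `^ alpha p) (s - tauSigma p u)].
Proof.
move=> uS [s0 sr]; rewrite /geo_path.
have e3 : crd3 (lin p s u) <= 1.
  rewrite /crd3 /lin /=; have -> : crd3 u = 1 by case: uS.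
  by rewrite mul1r -expR0 ler_expR oppr_le0 mulr_ge0// ltW// lambda3_gt0.
have [u0|u0] /= := eqVneq (crd1 u) 0.
  left; split => //.
  have -> : crd1 (lin p s u) = crd1 u * expR (lambda1 p * s) by [].
  by rewrite u0 mul0r normr0.
have [h|h] := leP s (tauSigma p u); [left; split => // | right; split => //].
- have -> : crd1 (lin p s u) = crd1 u * expR (lambda1 p * s) by [].
  rewrite normrM [`|expR _|]ger0_norm ?expR_ge0//.
  rewrite (norm_crd1_expR hp)// -expRD -expR0 ler_expR addrC.
  by rewrite -mulrBr pmulr_rle0 ?lambda1_gt0// subr_le0.
- by rewrite subr_gt0.
- by have := sr u0; rewrite /return_time; lra.
- by rewrite rot_phase_spiral.
Qed.

(** The linear phase lives in [|u_1| <= 1], [u_3 <= 1]; a rotating path is outside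
    the first slab during its first half turn, and above the second afterwards. *)
Lemma rot_not_lin u (e w2 : R) v : Ssec u -> crd1 u != 0 -> 0 < e ->
  e < 3 / 2 * pi ->
  v = spiral p (Num.sg (crd1 u)) 1 w2 (`|crd1 u| `^ alpha p) e ->
  1 < `|crd1 v| \/ 1 < crd3 v.
Proof.
move=> [u1 _ _] u0 e0 e1 ->; rewrite /spiral /crd1 /crd3 /= -/(crd1 u).
have [r0 _] := radius_bounds (powR_ge0 _ _) (powR_alpha_lt1 u1)
  (theta_powR_lt1 u1) (ltW e0) (ltW e1).
have [ep|ep] := ltP e pi; [left|right].
  have s0 : 0 < sin e by rewrite sin_gt0_pi// e0.
  have := mulr_gt0 r0 s0 => h.
  by rewrite normrM normr_sg u0 mul1r ger0_norm; lra.
have : 0 < cos (e - pi) by rewrite cos_gt0_pihalf//; have := pi_gt0 R; lra.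
have -> : cos (e - pi) = - cos e by rewrite cosB cospi sinpi; ring.
by move=> /(mulr_gt0 r0); lra.
Qed.

Lemma powR_inj (a x y : R) : a != 0 -> 0 < x -> 0 < y -> x `^ a = y `^ a -> x = y.
Proof.
move=> a0 x0 y0 /(congr1 (fun z => ln z)); rewrite !ln_powR => /(mulfI a0).
by apply: ln_inj; rewrite posrE.
Qed.

Lemma radius_inj (w w' e : R) : 0 <= e -> Defs.radius p w e = Defs.radius p w' e ->
  w = w'.
Proof.
move=> e0; rewrite /Defs.radius; have r1 := rot_time_ge1 R.
have s0 : 0 <= e / (3 / 2 * pi) by rewrite divr_ge0//; lra.
have t1 := theta_gt1 hp.
move: (e / _) s0 => s s0 h.
have h0 : 0 <= (theta p - 1) * s by rewrite mulr_ge0//; lra.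
have : (w - w') * (1 + (theta p - 1) * s) = 0 by lra.
by move/eqP; rewrite mulf_eq0 => /orP[|] /eqP; lra.
Qed.

Lemma polar_inj (r r' e e' : R) : 0 < r -> 0 < r' -> 0 <= e -> e < 2 * pi ->
  0 <= e' -> e' < 2 * pi -> r * sin e = r' * sin e' -> r * cos e = r' * cos e' ->
  r = r' /\ e = e'.
Proof.
move=> r0 r'0 e0 e1 e'0 e'1 hs hc.
have rr : r = r'.
  have /eqP : r ^+ 2 = r' ^+ 2.
    have c2 x : r ^+ 2 = (r * cos x) ^+ 2 + (r * sin x) ^+ 2.
      by rewrite !exprMn -mulrDr cos2Dsin2 mulr1.
    by rewrite (c2 e) hs hc !exprMn -mulrDr cos2Dsin2 mulr1.
  by rewrite eqrXn2 ?ltW// => /eqP.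
subst r'; split => //.
have rn : r != 0 by rewrite gt_eqF.
by apply: sin_cos_inj => //; apply: (mulfI rn).
Qed.

Lemma eq_crd u u' : crd1 u = crd1 u' -> crd2 u = crd2 u' -> crd3 u = crd3 u' ->
  u = u'.
Proof.
by case: u u' => -[x y] z [[x' y'] z']; rewrite /crd1 /crd2 /crd3/= => -> -> ->.
Qed.

(** A point of the attractor determines the path that it lies on and the time
    spent on it.  Rotating paths of the same side are separated by
    polar coordinates.  Rotating paths of opposite sides can have the same first
    coordinate only in the last third of both rotations, when their second
    coordinates have opposite signs. *)
Lemma geo_path_inj u u' (s s' : R) : Ssec u -> Ssec u' -> before_return p u s ->
  before_return p u' s' -> geo_path p u s = geo_path p u' s' -> u = u' /\ s = s'.
Proof.
move=> uS u'S us us'.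
have l3 := lambda3_gt0 hp.
case: (geo_path_cases uS us) => [[-> h1 h3]|[u0 e0 e1 ->]];
case: (geo_path_cases u'S us') => [[-> h1' h3']|[u'0 e'0 e'1 ->]].
- rewrite /lin => -[E1 E2 E3].
  have [_ _ u3] := uS; have [_ _ u'3] := u'S.
  move: E3; rewrite u3 u'3 !mul1r => /expR_inj/oppr_inj/(mulfI (lt0r_neq0 l3)) e.
  subst s'; have ne z0 : expR z0 != 0 :> R by rewrite gt_eqF// expR_gt0.
  move: E1 E2 => /(mulIf (ne _)) E1 /(mulIf (ne _)) E2; split => //.
  by apply: eq_crd; rewrite ?u3.
- by move=> /(rot_not_lin u'S u'0 e'0 e'1) []; lra.
- by move=> /esym /(rot_not_lin uS u0 e0 e1) []; lra.
have tauE : `|crd1 u| = `|crd1 u'| -> tauSigma p u = tauSigma p u'.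
  by rewrite /tauSigma => ->.
move: (s - tauSigma p u) (s' - tauSigma p u') (subrK (tauSigma p u) s)
  (subrK (tauSigma p u') s') e0 e1 e'0 e'1 => e e' se se' e0 e1 e'0 e'1.
have [u1 u2 u3] := uS; have [u'1 u'2 u'3] := u'S.
have [r0 r2] := radius_bounds (powR_ge0 _ _) (powR_alpha_lt1 u1)
  (theta_powR_lt1 u1) (ltW e0) (ltW e1).
have [r'0 r'2] := radius_bounds (powR_ge0 _ _) (powR_alpha_lt1 u'1)
  (theta_powR_lt1 u'1) (ltW e'0) (ltW e'1).
rewrite /spiral => -[E1 E2 E3].
have [sge|sgn] := eqVneq (Num.sg (crd1 u)) (Num.sg (crd1 u')).
  have sg0 : Num.sg (crd1 u') != 0 by rewrite sgr_eq0.
  move: E1 E2; rewrite sge => /(mulfI sg0) E1 E2.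
  move: E1 E3 => /addrI E1 /addrI/oppr_inj E3.
  have e2 x : x < 3 / 2 * pi -> x < 2 * pi :> R by have := pi_gt0 R; lra.
  have [rr ee] := polar_inj r0 r'0 (ltW e0) (e2 _ e1) (ltW e'0) (e2 _ e'1)
    E1 E3.
  subst e'.
  have an0 : alpha p != 0 by rewrite gt_eqF// alpha_gt0.
  have w3 : `|crd1 u| `^ alpha p = `|crd1 u'| `^ alpha p.
    exact: radius_inj (ltW e0) rr.
  have uu' : `|crd1 u| = `|crd1 u'|.
    by apply: powR_inj w3; rewrite ?normr_gt0.
  have c1 : crd1 u = crd1 u' by rewrite [LHS]numEsg sge uu' -numEsg.
  have c2 : crd2 u = crd2 u'.
    move: E2; rewrite uu' => /addIr; apply: mulIf.
    by rewrite gt_eqF// powR_gt0// normr_gt0.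
  split; last by rewrite -se -se' (tauE uu').
  by apply: eq_crd; rewrite ?u3.
exfalso.
have w2b v : Ssec v -> `|crd2 v * `|crd1 v| `^ beta p| < 1 / 6.
  move=> [v1 v2 _]; rewrite normrM [`|_ `^ _|]ger0_norm ?powR_ge0//.
  have := powR_beta_lt v1; have := powR_ge0 `|crd1 v| (beta p).
  by move: (_ `^ _) => b b0 b1; have := normr_ge0 (crd2 v); nra.
have {w2b} := (w2b _ uS, w2b _ u'S); rewrite !ltr_norml => -[b b'].
have pi0 := pi_gt0 R.
have sl : Num.sg (crd1 u) = - Num.sg (crd1 u') by move: sgn u0 u'0; do 2![case: sgrP]
  => //; rewrite ?eqxx ?opprK.
rewrite sl in E1 E2.
have E1' : Defs.radius p (`|crd1 u| `^ alpha p) e * sin e +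
   Defs.radius p (`|crd1 u'| `^ alpha p) e' * sin e' = - 2.
  have sg0 : Num.sg (crd1 u') != 0 by rewrite sgr_eq0.
  by move: E1; rewrite mulNr -mulrN => /(mulfI sg0); lra.
(* If [e < pi], the first term is positive and the second at least [-3/2]. *)
have side r x : 0 < r -> r <= 3 / 2 -> 0 < x -> pi > x -> 0 < r * sin x :> R.
  by move=> ? ? ? ?; rewrite mulr_gt0// sin_gt0_pi//; apply/andP.
have side2 (r x : R) : 0 < r -> r <= 3 / 2 -> - (3 / 2) <= r * sin x.
  by move=> ? ?; have := sin_max x; rewrite ler_norml => /andP[]; nra.
have pe : pi <= e.
  rewrite leNgt; apply/negP => h.
  by have := side _ _ r0 r2 e0 h; have := side2 _ e' r'0 r'2; lra.
have pe' : pi <= e'.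
  rewrite leNgt; apply/negP => h.
  by have := side _ _ r'0 r'2 e'0 h; have := side2 _ e r0 r2; lra.
have big x : pi <= x -> 1 / 6 <= 1 / 4 * (x / (3 / 2 * pi)) :> R.
  move=> px; have : 2 / 3 <= x / (3 / 2 * pi) :> R by rewrite ler_pdivlMr; lra.
  by lra.
have := (big _ pe, big _ pe') => -[].
move: E2 b b'; case: sgrP u'0 => // _ _; lra.
Qed.

Lemma orbit_Ssec n u : Ssec u ->
  (forall i, (i < n)%N -> crd1 (iter i (return_map p) u) != 0) ->
  Ssec (iter n (return_map p) u).
Proof.
move=> uS; elim: n => [//|n ih] h /=; apply: return_map_Ssec; last exact: h.
by apply: ih => i /ltnW; exact: h.
Qed.

Lemma nth_return_time0 u : nth_return_time p 0 u = 0.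
Proof. by rewrite /nth_return_time big_ord0. Qed.

Lemma nth_return_timeS n u : nth_return_time p n.+1 u =
  nth_return_time p n u + return_time p (iter n (return_map p) u).
Proof. by rewrite /nth_return_time big_ord_recr. Qed.

Lemma nth_return_timeSl n u : nth_return_time p n.+1 u =
  return_time p u + nth_return_time p n (return_map p u).
Proof.
rewrite /nth_return_time big_ord_recl; congr (_ + _).
by apply: eq_bigr => i _; rewrite -iterSr.
Qed.

(** Each turn lasts at least one unit of time, as the rotation alone does. *)
Lemma nth_return_time_ge u m n : Ssec u -> (m <= n)%N ->
  (forall i, (i < n)%N -> crd1 (iter i (return_map p) u) != 0) ->
  nth_return_time p m u + (n - m)%:R <= nth_return_time p n u.
Proof.
move=> uS; elim: n => [|n ih]; first by rewrite leqn0 => /eqP ->; rewrite addr0.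
rewrite leq_eqVlt => /orP[/eqP -> _|]; first by rewrite subnn addr0.
rewrite ltnS => mn h; have h' i : (i < n)%N -> crd1 (iter i (return_map p) u) != 0.
  by move/ltnW; exact: h.
have := ih mn h'; rewrite nth_return_timeS subSn// -natr1.
have := return_time_ge1 hp (orbit_Ssec uS h') (h n (ltnSn n)); lra.
Qed.

Lemma nth_return_time_mono u m n : Ssec u -> (m <= n)%N ->
  (forall i, (i < n)%N -> crd1 (iter i (return_map p) u) != 0) ->
  nth_return_time p m u <= nth_return_time p n u.
Proof.
by move=> uS mn h; apply: le_trans (nth_return_time_ge uS mn h); rewrite lerDl.
Qed.

Lemma nth_return_time_locate n u (T : R) : 0 <= T -> T < nth_return_time p n.+1 u ->
  exists2 m, (m <= n)%N & nth_return_time p m u <= T < nth_return_time p m.+1 u.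
Proof.
move=> T0; elim: n => [|n ih] h; first by exists 0%N; rewrite // nth_return_time0 T0.
have [/ih[m mn hm]|h'] := ltP T (nth_return_time p n.+1 u).
  by exists m => //; exact: leqW.
by exists n.+1; rewrite // h'.
Qed.

(** Concatenation of at most [n] turns, the last one being prolonged by a
    constant path as in [turn].  Unlike a definition by cases on the number of
    returns, this recursion makes the Lipschitz bound in time an induction. *)
Fixpoint flow (n : nat) (u : R * R * R) (T : R) : R * R * R :=
  if n is n'.+1 then
    if T < return_time p u then turn p u T
    else flow n' (return_map p u) (T - return_time p u)
  else turn p u T.

(** Starts on the section and does not hit [u_1 = 0] at returns [0] to [n]. *)
Definition regular n u :=
  Ssec u /\ forall i, (i <= n)%N -> crd1 (iter i (return_map p) u) != 0.

Lemma regular_return n u : regular n.+1 u -> regular n (return_map p u).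
Proof.
move=> [uS h]; split; first by apply: return_map_Ssec => //; exact: (h 0%N).
by move=> i ni; rewrite -iterSr; exact: h.
Qed.

Lemma regular_orbit n u m : regular n u -> (m <= n)%N ->
  Ssec (iter m (return_map p) u) /\ crd1 (iter m (return_map p) u) != 0.
Proof.
move=> [uS h] mn; split; last exact: h.
by apply: orbit_Ssec => // i im; apply: h; rewrite (leq_trans (ltnW im)).
Qed.

Lemma flow0 n u : regular n u -> flow n u 0 = u.
Proof.
move=> nu; have [uS u0] := @regular_orbit n u 0%N nu isT.
by case: n nu => [|n] _ /=; rewrite ?ifT ?turn0//;
  have := return_time_ge1 hp uS u0; lra.
Qed.

Lemma flow_turn n u m (t : R) : regular n u -> (m <= n)%N -> 0 <= t ->
  t <= return_time p (iter m (return_map p) u) ->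
  flow n u (nth_return_time p m u + t) = turn p (iter m (return_map p) u) t.
Proof.
elim: n u m => [|n ih] u m nu mn t0 tr.
  by move: mn tr; rewrite leqn0 => /eqP ->; rewrite nth_return_time0 add0r.
have [uS u0] := @regular_orbit _ u 0%N nu isT.
case: m mn tr => [|m] mn tr.
  rewrite nth_return_time0 add0r /=; case: ltP => // h.
  have -> : t = return_time p u by apply/eqP; rewrite eq_le tr h.
  by rewrite subrr flow0 ?turn_return//; exact: regular_return.
have nu' := regular_return nu.
have mT := @nth_return_time_mono (return_map p u) 0%N m.
rewrite nth_return_timeSl /= ltNge ifF.
  have -> : return_time p u + nth_return_time p m (return_map p u) + t -
    return_time p u = nth_return_time p m (return_map p u) + t by ring.
  by rewrite ih// -iterSr.
apply/negbF; rewrite -addrA lerDl addr_ge0//.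
rewrite -(nth_return_time0 (return_map p u)) mT//; first by case: nu'.
by move=> i im; case: nu' => _; apply; rewrite (leq_trans (ltnW im)).
Qed.

Lemma turn_lip_time u (t t' : R) : Ssec u -> crd1 u != 0 -> 0 <= t -> 0 <= t' ->
  `|turn p u t - turn p u t'| <= turnC p * `|t - t'|.
Proof.
move=> uS u0 t0 t'0; have := turn_lip hp uS uS u0 u0 erefl t0 t'0.
by rewrite !subrr !normr0 !addr0.
Qed.

Lemma flow_lip n u (T T' : R) : regular n u -> 0 <= T -> 0 <= T' ->
  `|flow n u T - flow n u T'| <= turnC p * `|T - T'|.
Proof.
elim: n u T T' => [|n ih] u T T' nu T0 T'0;
  have [uS u0] := @regular_orbit _ u 0%N nu isT; first exact: turn_lip_time.
have nu' := regular_return nu; have rt := return_time_ge1 hp uS u0.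
wlog TT' : T T' T0 T'0 / T <= T' => [hw|].
  have [/hw|/ltW TT] := leP T T'; first exact.
  by rewrite distrC [`|T - _|]distrC hw.
rewrite /=; case: ltP => hT; case: ltP => hT'.
- exact: turn_lip_time.
- rewrite (le_trans (ler_distD (turn p u (return_time p u)) _ _))//.
  have h1 : `|turn p u T - turn p u (return_time p u)| <=
    turnC p * (return_time p u - T).
    by rewrite -(ger0_norm (_ : 0 <= return_time p u - T)) ?(distrC _ T)
       ?turn_lip_time//; lra.
  have h2 : `|turn p u (return_time p u) -
              flow n (return_map p u) (T' - return_time p u)| <=
    turnC p * (T' - return_time p u).
    rewrite turn_return// -{1}(flow0 nu').
    rewrite (le_trans (ih _ _ _ _ _ _))//; try lra.
    by rewrite sub0r normrN ger0_norm; lra.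
  by rewrite [`|T - T'|]ler0_norm; lra.
- by lra.
- rewrite (le_trans (ih _ _ _ _ _ _))//; try lra.
  by rewrite opprB addrA subrK.
Qed.

(** Both choices hidden in [Psi], that of a path through the given point and that
    of the number of returns, are forced: the first by [geo_path_inj], the second
    because the return times increase. *)
Lemma Psi_flow n u (s t : R) : regular n u -> before_return p u s -> 0 <= t ->
  s + t < nth_return_time p n.+1 u ->
  Psi p t (geo_path p u s) = flow n u (s + t).
Proof.
move=> nu us t0 st; have [uS h0] := nu; have s0 : 0 <= s by case: us.
have [m mn /andP[h1 h2]] := nth_return_time_locate (addr_ge0 s0 t0) st.
have [umS um0] := regular_orbit nu mn.
have h2' : s + t - nth_return_time p m u <
    return_time p (iter m (return_map p) u).
  by move: h2; rewrite nth_return_timeS; lra.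
have -> : flow n u (s + t) = geo_path p (iter m (return_map p) u)
    (s + t - nth_return_time p m u).
  rewrite (geo_path_turn hp)// ?(ltW h2')// -(flow_turn nu mn) ?subr_ge0// ?(ltW h2')//.
  by rewrite addrCA subrr addr0.
apply: get_unique.
  exists u, s, m; split => //.
  - by move=> i im; apply: h0; rewrite (leq_trans (ltnW im)).
  - by split; rewrite ?subr_ge0.
move=> w [u' [s' [n' [[u'S us'] e hn' [h3 h4] <-]]]].
have [? ?] := geo_path_inj u'S uS us' us e; subst u' s'.
suff -> : n' = m by [].
apply/eqP; rewrite eqn_leq; apply/andP; split; rewrite leqNgt; apply/negP => lt.
  have := nth_return_time_mono u'S lt hn'; move: h3; rewrite subr_ge0; lra.
have n'0 : crd1 (iter n' (return_map p) u) != 0.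
  by apply: h0; rewrite (leq_trans (ltnW lt)).
have := h4 n'0.
have := @nth_return_time_mono u n'.+1 m u'S lt.
rewrite nth_return_timeS => h5.
have : forall i, (i < m)%N -> crd1 (iter i (return_map p) u) != 0.
  by move=> i im; apply: h0; rewrite (leq_trans (ltnW im)).
by move/h5; lra.
Qed.

End Semigroup.

(** * Orbits that shadow one another *)

Section Shadowing.
Variables (R : realType) (p : geo_params R).
Hypothesis hp : admissible p.
Implicit Types (u v : R * R * R).

(** Chosen so that [q^4] is the contraction rate of the inverse branches: one
    factor [q] is spent on turning distances into time lags, one on the
    number of sampling times per turn, and what is left is still summable. *)
Definition qrate : R := Num.sqrt (Num.sqrt (theta p * alpha p)^-1).
Local Notation q := qrate.

Lemma qrate4 : q ^+ 4 = (theta p * alpha p)^-1.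
Proof.
have h := theta_alpha_gt1 hp.
have h0 : 0 <= (theta p * alpha p)^-1 by rewrite invr_ge0; lra.
by rewrite -[4%N]/(2 * 2)%N exprM !sqr_sqrtr// sqrtr_ge0.
Qed.

Lemma qrate_gt0 : 0 < q.
Proof. by have h := theta_alpha_gt1 hp; rewrite !sqrtr_gt0 invr_gt0; lra. Qed.

Lemma qrate_lt1 : q < 1.
Proof.
have h := theta_alpha_gt1 hp; have q0 := qrate_gt0.
rewrite -(@expr_lt1 _ 4)// ?ltW// qrate4 invf_lt1//; lra.
Qed.

Lemma qrate_exprn_le (i j n : nat) : (j <= i)%N -> (q ^+ i) ^+ n <= (q ^+ j) ^+ n.
Proof.
move=> ji; have q0 := ltW qrate_gt0; have q1 := ltW qrate_lt1.
by rewrite lerXn2r ?nnegrE ?exprn_ge0// ler_wiXn2l.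
Qed.

(** [D] is the displacement at return [n]; seen from there, distances decay
    like [q^4] per turn whereas the distance to [u_1 = 0] may only shrink like
    [q]. *)
Definition shadow n (c D : R) v v' :=
  [/\ regular p n v, regular p n v', crd2 v = crd2 v' &
   forall m, (m <= n)%N ->
     let w := iter m (return_map p) v in let w' := iter m (return_map p) v' in
     [/\ c * q ^+ (n - m) <= `|crd1 w|, c * q ^+ (n - m) <= `|crd1 w'|,
      Num.sg (crd1 w) = Num.sg (crd1 w') &
      `|crd1 w - crd1 w'| <= (q ^+ 4) ^+ (n - m) * D]].

Lemma q3_lt1 : q ^+ 3 < 1.
Proof. by rewrite exprn_ilt1 ?ltW ?qrate_gt0 ?qrate_lt1. Qed.

Definition tauC (c : R) : R := (c * lambda1 p)^-1.

Lemma tauC_ge0 (c : R) : 0 < c -> 0 <= tauC c.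
Proof. by move=> c0; rewrite invr_ge0 mulr_ge0 ?ltW ?lambda1_gt0. Qed.

Definition shadowC (c : R) : R :=
  2 * turnC p * tauC c + beta p + turnC p * (tauC c / (1 - q ^+ 3)).

Lemma shadowC_ge0 (c : R) : 0 < c -> 0 <= shadowC c.
Proof.
move=> c0; have L := turnC_gt0 hp; have b1 := beta_gt1 hp.
have k0 := tauC_ge0 c0; have q3 := q3_lt1.
have h1 : 0 <= turnC p * tauC c by apply: mulr_ge0 => //; exact: ltW.
have h2 : 0 <= turnC p * (tauC c / (1 - q ^+ 3)).
  by apply: mulr_ge0; [exact: ltW | apply: divr_ge0 => //; lra].
rewrite /shadowC; lra.
Qed.

Section ShadowEstimates.
Variables (n : nat) (c D : R) (v v' : R * R * R).
Hypotheses (c0 : 0 < c) (sh : shadow n c D v v').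
Local Notation orb m := (iter m (return_map p) v).
Local Notation orb' m := (iter m (return_map p) v').

Let D0 : 0 <= D.
Proof.
have [_ _ _ /(_ n (leqnn n)) /= [_ _ _]] := sh.
by rewrite subnn expr0 mul1r => /(le_trans (normr_ge0 _)).
Qed.

(** The second coordinate is contracted by [1 / 3] at each turn and picks up
    at most [beta] times the distance of the first coordinates. *)
Lemma shadow_crd2 m : (m <= n)%N ->
  `|crd2 (orb m) - crd2 (orb' m)| <= beta p * (q ^+ 4) ^+ (n - m) * D.
Proof.
have q0 := qrate_gt0; have q1 := qrate_lt1; have b1 := beta_gt1 hp.
elim: m => [_|m ih mn].
  have [_ _ -> _] := sh; rewrite subrr normr0.
  rewrite -mulrA; apply: mulr_ge0; first by lra.
  by apply: mulr_ge0; rewrite ?exprn_ge0// ltW.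
have [rv rv' _ /(_ m (ltnW mn)) /= [a1 a2 a3 a4]] := sh.
have [oS o0] := regular_orbit hp rv (ltnW mn).
have [oS' o0'] := regular_orbit hp rv' (ltnW mn).
have {ih} := ih (ltnW mn).
have -> : (n - m = (n - m.+1).+1)%N by rewrite subnSK.
rewrite /= !crd2_return_map// -a3; move: a4.
have -> : (n - m = (n - m.+1).+1)%N by rewrite subnSK.
rewrite !(exprS (q ^+ 4)).
have k0 : 0 <= (q ^+ 4) ^+ (n - m.+1) * D by rewrite mulr_ge0 ?exprn_ge0// ltW.
have k1 : q ^+ 4 <= 1 by rewrite exprn_ile1 ?ltW.
have k0' : 0 <= q ^+ 4 by rewrite exprn_ge0 ?ltW.
move: (q ^+ 4) k0' k1 k0 => k k0' k1 k0.
rewrite -(mulrA k) -(mulrA (beta p) (k * _)) -(mulrA k) -(mulrA (beta p)).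
move: (k ^+ (n - m.+1) * D) k0 => r r0 d1 d2.
move: d1 d2 a1 a2 a3 oS o0 oS' o0'.
move: (orb m) (orb' m) => w w' d1 d2 a1 a2 a3 [w1 w2 _] w0 [w'1 w'2 _] w'0.
rewrite opprB addrA subrK (le_trans (distM _ _ _ _))//.
have p1 : `|crd2 w| * `| `|crd1 w| `^ beta p - `|crd1 w'| `^ beta p| <=
    1 / 2 * (beta p * r).
  rewrite ler_pM// (le_trans (powR_lip (ltW b1) _ _ _ _)) ?normr_gt0//; try lra.
  rewrite ler_wpM2l//; first by lra.
  rewrite (le_trans (ler_dist_dist _ _))// (le_trans d1)//.
  by rewrite ler_piMl.
have p2 : `| `|crd1 w'| `^ beta p| * `|crd2 w - crd2 w'| <=
    1 / 3 * (beta p * r).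
  rewrite ler_pM//.
    by rewrite ger0_norm ?powR_ge0// (ltW (powR_beta_lt hp _)).
  rewrite (le_trans d2)// ler_wpM2l//; first by lra.
  by rewrite ler_piMl.
have : 0 <= beta p * r by rewrite mulr_ge0//; lra.
lra.
Qed.

(** Dividing the distance by the distance to [u_1 = 0] costs one factor [q]. *)
Lemma shadow_tau m : (m <= n)%N ->
  `|tauSigma p (orb m) - tauSigma p (orb' m)| <=
  (tauC c) * ((q ^+ 3) ^+ (n - m) * D).
Proof.
move=> mn; have q0 := qrate_gt0; have l1 := lambda1_gt0 hp.
have [_ _ _ /(_ m mn) /= [a1 a2 a3 a4]] := sh.
have qn : 0 < q ^+ (n - m) by rewrite exprn_gt0.
have b0 : 0 < c * q ^+ (n - m) by rewrite mulr_gt0.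
rewrite (le_trans (tauSigma_lip hp b0 a1 a2))//.
have -> : (tauC c) * ((q ^+ 3) ^+ (n - m) * D) =
    (q ^+ 4) ^+ (n - m) * D / (c * q ^+ (n - m)) / lambda1 p.
  have -> : (q ^+ 4) ^+ (n - m) = (q ^+ 3) ^+ (n - m) * q ^+ (n - m).
    by rewrite -!exprM -exprD addnC -mulSn.
  by rewrite /tauC; field; rewrite !gt_eqF.
by rewrite !ler_wpM2r// invr_ge0 ltW.
Qed.

(** The lag at return [m] is the sum of the lags of the previous turns, whose
    bounds grow geometrically with the turn: the last one dominates. *)
Lemma shadow_time m : (m <= n)%N ->
  `|nth_return_time p m v - nth_return_time p m v'| <=
  (tauC c) / (1 - q ^+ 3) * ((q ^+ 3) ^+ (n - m) * D).
Proof.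
have q0 := qrate_gt0; have k0 := tauC_ge0 c0; have q31 := q3_lt1.
have q30 : 0 <= q ^+ 3 by rewrite exprn_ge0 ?ltW.
elim: m => [_|m ih mn].
  rewrite !nth_return_time0 subrr normr0; apply: mulr_ge0.
    by apply: divr_ge0 => //; lra.
  by apply: mulr_ge0 => //; exact: exprn_ge0.
rewrite !nth_return_timeS opprD addrACA (le_trans (ler_normD _ _))//.
have h2 := shadow_tau (ltnW mn).
have -> : return_time p (orb m) - return_time p (orb' m) =
  tauSigma p (orb m) - tauSigma p (orb' m) by rewrite /return_time; ring.
have {ih} := ih (ltnW mn); move: h2.
have -> : (n - m = (n - m.+1).+1)%N by rewrite subnSK.
rewrite exprS -mulrA; move: (q ^+ 3) q30 q31 => z q30 q31.
have r0 : 0 <= z ^+ (n - m.+1) * D by rewrite mulr_ge0 ?exprn_ge0.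
move: (z ^+ (n - m.+1) * D) r0 => r r0 h1 h2.
apply: (le_trans (lerD h2 h1)).
have -> : (tauC c) / (1 - z) * (z * r) + (tauC c) * (z * r) =
  (tauC c) / (1 - z) * r - (tauC c) * r * (1 - z) by field; lra.
rewrite gerBl !mulr_ge0//; lra.
Qed.

(** The two points are compared after the same time since their [m]-th returns;
    the lag is then paid with the speed of the flow. *)
Lemma shadow_flow m (t : R) : (m <= n)%N -> 0 <= t ->
  t <= return_time p (orb m) ->
  `|flow p n v (nth_return_time p m v + t) -
    flow p n v' (nth_return_time p m v + t)| <=
  shadowC c * ((q ^+ 3) ^+ (n - m) * D).
Proof.
move=> mn t0 tr; have [rv rv' _ /(_ m mn) /= [a1 a2 a3 a4]] := sh.
have [oS o0] := regular_orbit hp rv mn.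
have [oS' o0'] := regular_orbit hp rv' mn.
have r'0 := return_time_ge1 hp oS' o0'.
have L := ltW (turnC_gt0 hp).
pose t' := Num.min t (return_time p (orb' m)).
have t'0 : 0 <= t' by rewrite le_min t0; lra.
have cE : turn p (orb' m) t = turn p (orb' m) t'.
  rewrite /t'; case: leP => // /ltW h.
  by rewrite !turn_return.
have T0 w : regular p n w -> 0 <= nth_return_time p m w.
  move=> [wS wn]; rewrite -(nth_return_time0 p w) nth_return_time_mono//.
  by move=> i im; apply: wn; rewrite (leq_trans (ltnW im)).
rewrite (flow_turn hp rv mn t0 tr).
rewrite (le_trans (ler_distD (flow p n v' (nth_return_time p m v' + t')) _ _))//.
rewrite (flow_turn hp rv' mn t'0) ?ge_min ?lexx ?orbT// -cE.
have h1 := turn_lip hp oS oS' o0 o0' a3 t0 t0.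
have h2 := flow_lip hp rv' (addr_ge0 (T0 _ rv') t'0) (addr_ge0 (T0 _ rv) t0).
rewrite (flow_turn hp rv' mn t'0) ?ge_min ?lexx ?orbT// -cE in h2.
have h3 : `|nth_return_time p m v' + t' - (nth_return_time p m v + t)| <=
   `|nth_return_time p m v - nth_return_time p m v'| +
   `|tauSigma p (orb m) - tauSigma p (orb' m)|.
  rewrite opprD addrACA (le_trans (ler_normD _ _))// distrC lerD//.
  rewrite /t'; have [_|h] := leP t _; first by rewrite subrr normr0.
  rewrite ler0_norm; last by lra.
  rewrite (le_trans _ (ler_norm _))//; move: tr h; rewrite /return_time; lra.
have h4 := shadow_tau mn; have h5 := shadow_crd2 mn; have h6 := shadow_time mn.
have h7 : (q ^+ 4) ^+ (n - m) * D <= (q ^+ 3) ^+ (n - m) * D.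
  by rewrite ler_wpM2r// qrate_exprn_le.
have b1 := beta_gt1 hp.
rewrite subrr normr0 add0r in h1.
rewrite -mulrA in h5.
have h8 := le_trans h5 (ler_wpM2l (ltW (lt_trans ltr01 b1)) h7).
have h9 := ler_wpM2l L h4.
have h10 := ler_wpM2l L (le_trans h3 (lerD h6 h4)).
rewrite mulrDr in h10.
rewrite /shadowC; lra.
Qed.

Lemma shadow_flow_le (T : R) : 0 <= T -> T < nth_return_time p n.+1 v ->
  `|flow p n v T - flow p n v' T| <= shadowC c * D.
Proof.
move=> T0 /(nth_return_time_locate T0)[m mn /andP[h1 h2]].
have := @shadow_flow m (T - nth_return_time p m v) mn.
rewrite addrCA subrr addr0 subr_ge0 => /(_ h1).
move: h2; rewrite nth_return_timeS => h2 /(_ _)/le_trans; apply; first by lra.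
rewrite ler_wpM2l ?(shadowC_ge0 c0)// ler_piMl// exprn_ile1 ?exprn_ge0//.
- exact/ltW/qrate_gt0.
- exact/ltW/q3_lt1.
Qed.

End ShadowEstimates.

(** Invariant of the induction on [N]: the number of sampling times found in the
    window so far is at most the covered part of the window, prolonged by [h],
    divided by [h]. *)
Lemma count_window (s h A l : R) N : 0 < h -> 0 <= l ->
  \sum_(0 <= i < N) (A <= s + i%:R * h < A + l)%R%:R <= l / h + 1.
Proof.
move=> h0 l0.
have lh0 : 0 <= l / h by rewrite divr_ge0// ltW.
have : \sum_(0 <= i < N) (A <= s + i%:R * h < A + l)%R%:R <=
  Num.max 0 ((Num.min (s + N%:R * h) (A + l + h) - A) / h).
  elim: N => [|N ih]; first by rewrite big_nil le_max lexx.
  rewrite big_nat_recr//=; move: ih.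
  move: (\sum_(0 <= i < N) _) => S ih.
  have sN : s + N.+1%:R * h = s + N%:R * h + h by rewrite -natr1; ring.
  rewrite sN; move: (s + N%:R * h) ih => x ih.
  have le2 : Num.min x (A + l + h) <= Num.min (x + h) (A + l + h).
    by rewrite le_min ge_min lerDl (ltW h0) /= ge_min lexx orbT.
  have [/andP[xA xl]|_] := boolP (A <= x < A + l); last first.
    rewrite addr0 (le_trans ih)// ge_max le_max lexx /= le_max; apply/orP; right.
    by rewrite ler_wpM2r ?invr_ge0 ?(ltW h0)// lerD2r.
  rewrite le_max; apply/orP; right; rewrite (min_l (_ : x + h <= A + l + h)); last by lra.
  have -> : (x + h - A) / h = (x - A) / h + 1 by field; rewrite gt_eqF.
  rewrite lerD2r (le_trans ih)// ge_max divr_ge0 ?subr_ge0 ?(ltW h0)//=.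
  by rewrite ler_wpM2r ?invr_ge0 ?(ltW h0)// lerD2r ge_min lexx.
move/le_trans; apply; rewrite ge_max addr_ge0//=.
have -> : l / h + 1 = (A + l + h - A) / h by field; rewrite gt_eqF.
by rewrite ler_wpM2r ?invr_ge0 ?(ltW h0)// lerD2r ge_min lexx orbT.
Qed.

Lemma geometric_sum_le (z : R) n : 0 <= z -> z < 1 ->
  \sum_(m < n.+1) z ^+ (n - m) <= (1 - z)^-1.
Proof.
move=> z0 z1; rewrite (reindex_inj rev_ord_inj) /=.
rewrite (eq_bigr (fun i : 'I_n.+1 => z ^+ i)); last first.
  by move=> i _; rewrite subSS subKn// -ltnS.
have h := subrX1 z n.+1.
rewrite -[leRHS]mul1r ler_pdivlMr; last by lra.
have := exprn_ge0 n.+1 z0; lra.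
Qed.

Definition shadow_sumC (c h : R) : R :=
  shadowC c * (((lambda1 p)^-1 + 3 / 2 * pi) / h + 1) / c / (1 - q ^+ 2).

Lemma shadow_sumC_ge0 c h : 0 < c -> 0 < h -> 0 <= shadow_sumC c h.
Proof.
move=> c0 h0; rewrite /shadow_sumC.
have q21 : q ^+ 2 < 1 by rewrite exprn_ilt1 ?ltW ?qrate_gt0 ?qrate_lt1.
have l1 := lambda1_gt0 hp; have r1 := rot_time_ge1 R.
have l1V : 0 <= (lambda1 p)^-1 by rewrite invr_ge0 ltW.
have K0 : 0 <= ((lambda1 p)^-1 + 3 / 2 * pi) / h + 1.
  by rewrite addr_ge0// divr_ge0 ?(ltW h0)//; lra.
apply: divr_ge0; last by lra.
by apply: divr_ge0; [apply: mulr_ge0; rewrite // shadowC_ge0 | exact: ltW].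
Qed.

Lemma return_time_le u : Ssec u -> crd1 u != 0 ->
  return_time p u <= ((lambda1 p)^-1 + 3 / 2 * pi) / `|crd1 u|.
Proof.
move=> [u1 _ _] u0; have l1 := lambda1_gt0 hp; have r1 := rot_time_ge1 R.
have a0 : 0 < `|crd1 u| by rewrite normr_gt0.
have aV : 1 <= `|crd1 u|^-1 by rewrite invf_ge1//; lra.
rewrite /return_time /tauSigma [leRHS]mulrDl.
apply: lerD; last by rewrite ler_peMr//; lra.
rewrite ler_wpM2l ?invr_ge0 ?(ltW l1)// div1r ltW// ln_sublinear// invr_gt0//.
Qed.

(** The sampling times are sorted by the turn of [v] into which they fall.  Turn
    [m] contains [O(q^(- (n - m)))] of them, each contributing [O(q^(3 (n - m)))]. *)
Lemma shadow_sum n c D v v' (s h : R) N : 0 < c -> shadow n c D v v' ->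
  0 < h -> 0 <= s ->
  (forall i, (i < N)%N -> s + i%:R * h < nth_return_time p n.+1 v) ->
  \sum_(0 <= i < N) `|flow p n v (s + i%:R * h) - flow p n v' (s + i%:R * h)| <=
  shadow_sumC c h * D.
Proof.
move=> c0 sh h0 s0 hN; have [rv rv' _ hsh] := sh.
have q0 := qrate_gt0; have q1 := qrate_lt1.
have l1 := lambda1_gt0 hp; have r1 := rot_time_ge1 R.
have l1V : 0 <= (lambda1 p)^-1 by rewrite invr_ge0 ltW.
have D0 : 0 <= D.
  have [_ _ _] := hsh _ (leqnn n).
  by rewrite subnn expr0 mul1r => /(le_trans (normr_ge0 _)).
have C0 := shadowC_ge0 c0.
pose B m := shadowC c * ((q ^+ 3) ^+ (n - m) * D).
have B0 m : 0 <= B m.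
  by apply: mulr_ge0 => //; apply: mulr_ge0; rewrite // !exprn_ge0// ltW.
pose I m i := (nth_return_time p m v <= s + i%:R * h <
  nth_return_time p m v + return_time p (iter m (return_map p) v)).
have step1 i : (i < N)%N ->
  `|flow p n v (s + i%:R * h) - flow p n v' (s + i%:R * h)| <=
  \sum_(m < n.+1) (I m i)%:R * B m.
  move=> iN; have T0 : 0 <= s + i%:R * h by rewrite addr_ge0// mulr_ge0// ltW.
  have [m mn] := nth_return_time_locate T0 (hN i iN).
  rewrite nth_return_timeS => hm.
  rewrite (bigD1 (Ordinal (mn : (m < n.+1)%N)))//= /I hm mul1r.
  rewrite -[leLHS]addr0 lerD//; last by apply: sumr_ge0 => j _; rewrite mulr_ge0.
  move: hm => /andP[h1 h2].
  have := @shadow_flow n c D v v' c0 sh m (s + i%:R * h - nth_return_time p m v) mn.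
  rewrite addrCA subrr addr0 subr_ge0 => /(_ h1); apply; lra.
have step2 : \sum_(0 <= i < N)
   `|flow p n v (s + i%:R * h) - flow p n v' (s + i%:R * h)| <=
   \sum_(m < n.+1) B m * \sum_(0 <= i < N) (I m i)%:R.
  apply: (@le_trans _ _ (\sum_(0 <= i < N) \sum_(m < n.+1) (I m i)%:R * B m)).
    by rewrite big_nat [leRHS]big_nat; apply: ler_sum => i /andP[_]; exact: step1.
  rewrite exchange_big /=; apply: ler_sum => m _.
  by rewrite mulr_sumr; apply: ler_sum => i _; rewrite mulrC.
apply: (le_trans step2); set K := (((lambda1 p)^-1 + 3 / 2 * pi) / h + 1).
have K0 : 0 <= K by rewrite addr_ge0// divr_ge0 ?(ltW h0)//; lra.
have step3 (m : 'I_n.+1) : B m * \sum_(0 <= i < N) (I m i)%:R <=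
   shadowC c * K / c * D * (q ^+ 2) ^+ (n - m).
  have mn : (m <= n)%N by rewrite -ltnS.
  have [oS o0] := regular_orbit hp rv mn.
  have [a1 _ _ _] := hsh m mn.
  have qn : 0 < q ^+ (n - m) by rewrite exprn_gt0.
  have cq : 0 < c * q ^+ (n - m) by rewrite mulr_gt0.
  have rt := return_time_ge1 hp oS o0.
  have cnt : \sum_(0 <= i < N) (I m i)%:R <= K / (c * q ^+ (n - m)).
    have := count_window s (nth_return_time p m v) N h0 (le_trans ler01 rt).
    move/le_trans; apply.
    have aV : 1 <= `|crd1 (iter m (return_map p) v)|^-1.
      by rewrite invf_ge1 ?normr_gt0//; have [? _ _] := oS; lra.
    apply: (@le_trans _ _ (K / `|crd1 (iter m (return_map p) v)|)).
      rewrite /K [leRHS]mulrDl mul1r lerD// mulrAC ler_wpM2r ?invr_ge0 ?(ltW h0)//.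
      exact: return_time_le.
    rewrite ler_wpM2l// lef_pV2// posrE// normr_gt0//.
  apply: (le_trans (ler_wpM2l (B0 m) cnt)); rewrite le_eqVlt; apply/orP; left.
  apply/eqP; rewrite /B.
  have -> : (q ^+ 3) ^+ (n - m) = (q ^+ 2) ^+ (n - m) * q ^+ (n - m).
    by rewrite -!exprM -exprD addnC -mulSn.
  by field; rewrite !gt_eqF.
apply: (@le_trans _ _ (\sum_(m < n.+1) shadowC c * K / c * D * (q ^+ 2) ^+ (n - m))).
  by apply: ler_sum => m _; exact: step3.
rewrite -mulr_sumr /shadow_sumC -/K.
have q20 : 0 <= q ^+ 2 by rewrite exprn_ge0// ltW.
have q21 : q ^+ 2 < 1 by rewrite exprn_ilt1 ?ltW.
rewrite [leRHS]mulrAC ler_wpM2l ?geometric_sum_le//.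
apply: mulr_ge0 => //; apply: divr_ge0; last exact: ltW.
by apply: mulr_ge0.
Qed.

End Shadowing.

(** * Inverse branches and pieces of unstable leaves *)

Section InverseBranches.
Variables (R : realType) (p : geo_params R).
Hypothesis hp : admissible p.
Local Notation q := (qrate p).
Local Notation f := (fmap1 p).

Definition inverse_branch (sg y : R) : R := sg * ((1 / 2 + sg * y) / theta p) `^ (alpha p)^-1.

(** The preimage of [y] under the [n]-th iterate of [f], through the branches
    that the orbit of [x] takes. *)
Fixpoint pullback (n : nat) (x y : R) : R :=
  if n is n'.+1 then inverse_branch (Num.sg x) (pullback n' (f x) y) else y.

Lemma fmap1E (x : R) : x != 0 ->
  f x = Num.sg x * (theta p * `|x| `^ alpha p - 1 / 2).
Proof. by rewrite /fmap1; case: sgrP => // x0 _; ring. Qed.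

Lemma fmap1_expand (x z : R) : x != 0 -> Num.sg x = Num.sg z -> `|x| <= 1 ->
  `|z| <= 1 -> `|x - z| <= q ^+ 4 * `|f x - f z|.
Proof.
move=> x0 sxz x1 z1; have z0 : z != 0 by rewrite -sgr_eq0 -sxz sgr_eq0.
have ta := theta_alpha_gt1 hp; have t1 := theta_gt1 hp.
rewrite (qrate4 hp) mulrC ler_pdivlMr; last by lra.
rewrite !fmap1E// -sxz -mulrBr {1}[x]numEsg {1}[z]numEsg -sxz -mulrBr !normrM.
rewrite normr_sg x0 !mul1r opprB addrA subrK -mulrBr normrM.
rewrite [`|theta p|]gtr0_norm; last by lra.
rewrite mulrC -mulrA ler_wpM2l//; first by lra.
move: x0 z0 x1 z1; rewrite -!normr_gt0; move: `|x| `|z| => a b {x z sxz}.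
have a0 := ltW (alpha_gt0 hp); have a1 := ltW (alpha_lt1 hp).
wlog ba : a b / b <= a => [hw|] p0 p0' p1 p1'.
  have [ba|/ltW ab] := leP b a; first exact: hw.
  by rewrite distrC [leRHS]distrC; apply: hw.
rewrite (ger0_norm (_ : 0 <= a - b)) ?subr_ge0//.
by rewrite (le_trans (powR_expand a0 a1 p0' ba p1))// ler_norm.
Qed.

Lemma inverse_branchK (x y : R) : x != 0 -> `|y| < 1 / 2 ->
  [/\ Num.sg (inverse_branch (Num.sg x) y) = Num.sg x, `|inverse_branch (Num.sg x) y| <= 1 &
      f (inverse_branch (Num.sg x) y) = y].
Proof.
move=> x0; rewrite ltr_norml => /andP[y1 y2].
have t1 := theta_gt1 hp; have a0 := alpha_gt0 hp.
have sg2 : Num.sg x * Num.sg x = 1 by rewrite -expr2 sqr_sg x0.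
have w0 : 0 < 1 / 2 + Num.sg x * y by case: sgrP x0 => // _ _; lra.
have w1 : 1 / 2 + Num.sg x * y < 1 by case: sgrP x0 => // _ _; lra.
set w := 1 / 2 + Num.sg x * y in w0 w1 *.
have wt0 : 0 < w / theta p by rewrite divr_gt0//; lra.
have wt1 : w / theta p <= 1 by rewrite ler_pdivrMr; lra.
have r0 : 0 < (w / theta p) `^ (alpha p)^-1 by rewrite powR_gt0.
have bN : `|inverse_branch (Num.sg x) y| = (w / theta p) `^ (alpha p)^-1.
  by rewrite /inverse_branch -/w normrM normr_sg x0 mul1r gtr0_norm.
have bS : Num.sg (inverse_branch (Num.sg x) y) = Num.sg x.
  by rewrite /inverse_branch -/w sgrM (gtr0_sg r0) mulr1 sgr_id.
split=> //.
  have e1 : 1 = 1 `^ (alpha p)^-1 :> R by rewrite powR1.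
  rewrite bN [leRHS]e1 ge0_ler_powR ?nnegrE ?invr_ge0 ?(ltW a0)//.
  exact: ltW.
have b0 : inverse_branch (Num.sg x) y != 0 by rewrite -sgr_eq0 bS sgr_eq0.
rewrite fmap1E// bS bN -powRrM mulVf ?gt_eqF//.
have tn : theta p != 0 by rewrite gt_eqF//; lra.
rewrite powRr1 ?(ltW wt0)// mulrCA mulfV// mulr1.
have -> : Num.sg x * (w - 1 / 2) = Num.sg x * Num.sg x * y by rewrite /w; ring.
by rewrite sg2 mul1r.
Qed.

(** The closer a return is to return [n], the farther it must stay from the ends
    [0] and [+-1/2] of the branches. *)
Definition away n (c x : R) := forall m, (m <= n)%N ->
  c * q ^+ (n - m) <= `|iter m f x| <= 1 / 2 - c * q ^+ (n - m).

Lemma awayS n c x : away n.+1 c x -> away n c (f x).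
Proof. by move=> h m mn; rewrite -iterSr; have := h m.+1 mn; rewrite subSS. Qed.

Lemma away_iter n c x m : (m <= n)%N -> away n c x -> away (n - m) c (iter m f x).
Proof.
move=> mn h j jm; rewrite -iterD addnC.
have := h (m + j)%N; rewrite subnDA; apply.
by rewrite -(subnKC mn) leq_add2l.
Qed.

Lemma away_neq0 n c x : 0 < c -> away n c x -> x != 0.
Proof.
move=> c0 /(_ 0%N isT) /andP[h _]; rewrite -normr_gt0 (lt_le_trans _ h)//.
by rewrite mulr_gt0// exprn_gt0// qrate_gt0.
Qed.

Lemma away_q n c (d : R) : 0 <= c -> d <= c / 2 ->
  (q ^+ 4) ^+ n * d <= c / 2 * q ^+ n.
Proof.
move=> c0 dc; have q0 := qrate_gt0 hp.
have h : (q ^+ 4) ^+ n <= (q ^+ 1) ^+ n by exact: qrate_exprn_le.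
rewrite expr1 in h; have q4 : 0 <= (q ^+ 4) ^+ n by rewrite !exprn_ge0// ltW.
rewrite (le_trans (ler_wpM2l q4 dc))// mulrC ler_wpM2l//; lra.
Qed.

(** The pulled-back point stays inside the branch because the pull-back shrinks
    by [q^4] at each step and the room shrinks only by [q]. *)
Lemma pullback_near n c x y : 0 < c -> away n c x -> `|y - iter n f x| <= c / 2 ->
  `|pullback n x y - x| <= (q ^+ 4) ^+ n * `|y - iter n f x|.
Proof.
move=> c0; elim: n x => [|n ih] x h hy; first by rewrite /= expr0 mul1r.
rewrite iterSr in hy *.
have {ih} := ih _ (awayS h) hy; have x0 := away_neq0 c0 h.
have := away_q n (ltW c0) hy.
have := h 0%N isT; have /(_ 1%N isT) := h; rewrite subn0 subSS subn0 /=.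
have qn : 0 < c * q ^+ n by rewrite mulr_gt0// exprn_gt0// qrate_gt0.
have qn1 : 0 < c * q ^+ n.+1 by rewrite mulr_gt0// exprn_gt0// qrate_gt0.
move: (pullback n _ _) => z1 /andP[f1 f2] /andP[x1 x2] e1 e2.
have z12 : `|z1| < 1 / 2.
  have -> : z1 = (z1 - f x) + f x by rewrite subrK.
  rewrite (le_lt_trans (ler_normD _ _))//; lra.
have [b1 b2 b3] := inverse_branchK x0 z12.
rewrite distrC (le_trans (fmap1_expand x0 (esym b1) _ b2))//; first by lra.
rewrite b3 (exprS (q ^+ 4)) -mulrA ler_wpM2l// ?exprn_ge0 ?(ltW (qrate_gt0 hp))//.
by rewrite distrC.
Qed.

Lemma pullback_bounds n c x y : 0 < c -> away n c x -> `|y - iter n f x| <= c / 2 ->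
  [/\ Num.sg (pullback n x y) = Num.sg x, c / 2 * q ^+ n <= `|pullback n x y| &
      `|pullback n x y| < 1 / 2].
Proof.
move=> c0 h hy; have h1 := pullback_near c0 h hy.
have h2 := away_q n (ltW c0) hy.
have /andP[] := h 0%N isT; rewrite subn0 /=.
have qn : 0 < c * q ^+ n by rewrite mulr_gt0// exprn_gt0// qrate_gt0.
move: (pullback n x y) h1 => z h1 h3 h4; have h5 := le_trans h1 h2.
have x0 := away_neq0 c0 h.
move: h5 h3 h4; rewrite ler_norml; case: (sgrP x) x0 => // x0 _ /andP[? ?].
  move=> ? ?; have z0 : 0 < z by lra.
  by rewrite (gtr0_sg z0) (gtr0_norm z0); split; lra.
move=> ? ?; have z0 : z < 0 by lra.
by rewrite (ltr0_sg z0) (ltr0_norm z0); split; lra.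
Qed.

Lemma fmap1_pullback n c x y : 0 < c -> away n.+1 c x ->
  `|y - iter n.+1 f x| <= c / 2 -> f (pullback n.+1 x y) = pullback n (f x) y.
Proof.
move=> c0 h; rewrite iterSr => hy.
have [_ _ h1] := pullback_bounds c0 (awayS h) hy.
by have [_ _] := inverse_branchK (away_neq0 c0 h) h1.
Qed.

Lemma pullback_lip n c x y y' : 0 < c -> away n c x -> `|y - iter n f x| <= c / 2 ->
  `|y' - iter n f x| <= c / 2 ->
  `|pullback n x y - pullback n x y'| <= (q ^+ 4) ^+ n * `|y - y'|.
Proof.
move=> c0; elim: n x => [|n ih] x h hy hy'; first by rewrite /= expr0 mul1r.
have [s1 l1 u1] := pullback_bounds c0 h hy; have [s2 l2 u2] := pullback_bounds c0 h hy'.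
have x0 := away_neq0 c0 h.
rewrite (le_trans (fmap1_expand _ _ _ _)) ?s1 ?s2//; try lra.
  by rewrite -sgr_eq0 s1 sgr_eq0.
rewrite (fmap1_pullback c0 h hy) (fmap1_pullback c0 h hy').
rewrite iterSr in hy hy'.
rewrite (exprS (q ^+ 4)) -mulrA ler_wpM2l// ?exprn_ge0 ?(ltW (qrate_gt0 hp))//.
by rewrite ih//; exact: awayS.
Qed.

Variables (n : nat) (c : R) (u : R * R * R).
Hypotheses (c0 : 0 < c) (uS : Ssec u) (hu : away n c (crd1 u)).
Local Notation near y := (`|y - iter n f (crd1 u)| <= c / 2).

Definition leaf (y : R) : R * R * R := (pullback n (crd1 u) y, crd2 u, 1).

Lemma leaf_orbit y m : near y -> (m <= n)%N ->
  (crd1 (iter m (return_map p) (leaf y)) = pullback (n - m) (iter m f (crd1 u)) y) /\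
  (crd1 (iter m (return_map p) (leaf y)) != 0).
Proof.
move=> hy mn.
have pn k : (k <= n)%N -> pullback (n - k) (iter k f (crd1 u)) y != 0.
  move=> kn; have hk := away_iter kn hu.
  have hyk : `|y - iter (n - k) f (iter k f (crd1 u))| <= c / 2.
    by rewrite -iterD subnK.
  have [s _ _] := pullback_bounds c0 hk hyk.
  by rewrite -sgr_eq0 s sgr_eq0 (away_neq0 c0 hk).
elim: m mn => [mn|m ih mn].
  by have := pn 0%N isT; rewrite !subn0 /leaf /crd1 /=.
have [e ne] := ih (ltnW mn).
have hk := away_iter (ltnW mn) hu.
have -> : crd1 (iter m.+1 (return_map p) (leaf y)) =
    pullback (n - m.+1) (iter m.+1 f (crd1 u)) y.
  rewrite /= crd1_return_map// e; move: hk; rewrite -subnSK// => hk.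
  rewrite (fmap1_pullback c0 hk)// -iterD.
  by rewrite subnSK// subnK// ltnW.
by rewrite pn.
Qed.

Lemma leaf_regular y : near y -> regular p n (leaf y).
Proof.
move=> hy; split; last by move=> i ni; have [] := leaf_orbit hy ni.
have [_ _ h] := pullback_bounds c0 hu hy.
by split => //; [rewrite /leaf /crd1 /= ltW | case: uS].
Qed.

Lemma leaf_end y : near y -> crd1 (iter n (return_map p) (leaf y)) = y.
Proof. by move=> hy; have [-> _] := leaf_orbit hy (leqnn n); rewrite subnn. Qed.

Lemma leaf_base : leaf (iter n f (crd1 u)) = u.
Proof.
have hc : near (iter n f (crd1 u)) by rewrite subrr normr0 divr_ge0// ltW.
have := pullback_near c0 hu hc; rewrite subrr normr0 mulr0 normr_le0 subr_eq0.
move=> /eqP e; have [_ _ u3] := uS.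
by apply: eq_crd => //; rewrite u3.
Qed.

(** All estimates are for pairs of points of the leaf, not only for one point
    and the base point, so that they also give the continuity of the leaf. *)
Lemma leaf_shadow y y' : near y -> near y' ->
  shadow p n (c / 2) `|y - y'| (leaf y) (leaf y').
Proof.
move=> hy hy'; split; [exact: leaf_regular | exact: leaf_regular | by [] |].
move=> m mn /=; have hk := away_iter mn hu.
have [-> _] := leaf_orbit hy mn; have [-> _] := leaf_orbit hy' mn.
have e : iter (n - m) f (iter m f (crd1 u)) = iter n f (crd1 u).
  by rewrite -iterD subnK.
rewrite -e in hy hy'.
have [s l _] := pullback_bounds c0 hk hy; have [s' l' _] := pullback_bounds c0 hk hy'.
split => //; first by rewrite s s'.
exact: pullback_lip c0 hk hy hy'.
Qed.

End InverseBranches.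

(** * Typical points come close to the singularities rarely *)

Section Recurrence.
Variables (R : realType) (p : geo_params R).
Hypothesis hp : admissible p.
Variable mu : probability (measurableTypeR R) R.
Hypothesis hmu : is_mu_f p mu.
Local Notation q := (qrate p).
Local Notation f := (fmap1 p).

Lemma measurable_fmap1 : measurable_fun [set: measurableTypeR R]
  (f : measurableTypeR R -> measurableTypeR R).
Proof.
have mabs : measurable_fun [set: measurableTypeR R]
    ((fun x => theta p * `|x| `^ alpha p) : measurableTypeR R -> R).
  apply: measurable_funM; first exact: measurable_cst.
  exact: (measurableT_comp (measurable_powR (alpha p)) (@normr_measurable R setT)).
apply: measurable_fun_ifT; first exact: measurable_realfun.measurable_fun_ltr.
  exact: measurable_funB.
apply: measurable_fun_ifT => //; first exact: measurable_realfun.measurable_fun_ltr.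
apply: measurable_funD => //.
apply: (measurableT_comp _ mabs); exact: oppr_measurable.
Qed.

Lemma measurable_iter_fmap1 m : measurable_fun [set: measurableTypeR R]
  (iter m f : measurableTypeR R -> measurableTypeR R).
Proof.
elim: m => [|m ih]; first exact: measurable_id.
exact: (measurableT_comp measurable_fmap1 ih).
Qed.

Lemma mu_iter_preimage m (A : set (measurableTypeR R)) : measurable A ->
  mu (iter m f @^-1` A) = mu A.
Proof.
elim: m A => [//|m ih] A mA.
have mfA : measurable (f @^-1` A : set (measurableTypeR R)).
  by rewrite -[X in measurable X]setTI; exact: measurable_fmap1.
transitivity (mu (iter m f @^-1` (f @^-1` A))).
  by congr (mu _); apply/seteqP; split => x.
by rewrite ih// (acip_invariant (mu_f_acip hmu)).
Qed.

Definition window (a r : R) : set (measurableTypeR R) := `]a - r, a + r[.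

Lemma measurable_window a r : measurable (window a r).
Proof. exact: measurable_itv. Qed.

Lemma mu_interval_le : exists2 M : R, 0 <= M & forall a r : R, 0 <= r ->
  (mu (window a r) <= (2 * M * r)%:E)%E.
Proof.
have [g [M [mg gM mug]]] := mu_f_bounded_density hmu.
have M0 : 0 <= M by have /andP[g0 gM0] := gM 0; exact: le_trans g0 gM0.
exists M => // a r r0.
have mI := measurable_window a r.
rewrite mug//; apply: (@le_trans _ _
  (\int[lebesgue_measure]_(x in window a r) (cst M%:E x))%E).
  apply: ge0_le_integral => //.
  - by move=> x _; rewrite lee_fin; have /andP[] := gM x.
  - by apply/measurable_EFinP; apply: measurable_funTS.
  - by move=> x _; rewrite lee_fin; have /andP[] := gM x.
have eL : (lebesgue_measure (window a r : set R) <= (2 * r)%:E)%E.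
  rewrite /window lebesgue_measure_itv/= lte_fin.
  case: ifP => _; last by rewrite lee_fin mulr_ge0.
  by rewrite -EFinB lee_fin; lra.
rewrite integral_cst//; apply: (le_trans (lee_wpmul2l _ eL)).
  by rewrite lee_fin.
by rewrite -EFinM lee_fin; lra.
Qed.

Definition cut_nbhd (r : R) : set (measurableTypeR R) :=
  window 0 r `|` (window (1 / 2) r `|` window (- (1 / 2)) r).

Lemma measurable_cut_nbhd r : measurable (cut_nbhd r).
Proof. by rewrite /cut_nbhd; do 2?[apply: measurableU]; exact: measurable_window. Qed.

Lemma mu_cut_nbhd_le : exists2 M : R, 0 <= M & forall r : R, 0 <= r ->
  (mu (cut_nbhd r) <= (M * r)%:E)%E.
Proof.
(* Three windows, each of length [2 * r]. *)
have [M M0 hM] := mu_interval_le; exists (6 * M); first by rewrite mulr_ge0.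
move=> r r0; rewrite /cut_nbhd.
have m1 a := measurable_window a r.
apply: (le_trans (measureU2 _ (m1 _) (measurableU _ _ (m1 _) (m1 _)))).
apply: (@le_trans _ _ ((2 * M * r)%:E + ((2 * M * r)%:E + (2 * M * r)%:E))%E).
  apply: leeD; first exact: hM.
  apply: (le_trans (measureU2 _ (m1 _) (m1 _))).
  by apply: leeD; exact: hM.
by rewrite -!EFinD lee_fin; lra.
Qed.

Definition bad n (c : R) : set (measurableTypeR R) :=
  \big[setU/set0]_(m < n.+1) (iter m f @^-1` cut_nbhd (c * q ^+ (n - m))).

Lemma measurable_bad n c : measurable (bad n c).
Proof.
apply: bigsetU_measurable => m _.
rewrite -[X in measurable X]setTI; apply: measurable_iter_fmap1 => //.
exact: measurable_cut_nbhd.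
Qed.

Lemma iter_fmap1_bound m (x : R) : `|x| <= 1 / 2 -> `|iter m f x| <= 1 / 2.
Proof. by move=> x2; elim: m => //= m ih; exact: fmap1_bound. Qed.

Lemma away_bad n c x : `|x| <= 1 / 2 -> ~ bad n c x -> away p n c x.
Proof.
move=> x2 nb m mn; have := iter_fmap1_bound m x2.
have : ~ cut_nbhd (c * q ^+ (n - m)) (iter m f x).
  by move=> h; apply: nb; rewrite /bad (bigD1 (Ordinal (mn : (m < n.+1)%N)))//; left.
rewrite /cut_nbhd /window /= !in_itv /= => h y2; have {h} [h1 [h2 h3]] : 
    ~ (0 - c * q ^+ (n - m) < iter m f x < 0 + c * q ^+ (n - m)) /\
    (~ (1 / 2 - c * q ^+ (n - m) < iter m f x < 1 / 2 + c * q ^+ (n - m)) /\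
    ~ (- (1 / 2) - c * q ^+ (n - m) < iter m f x < - (1 / 2) + c * q ^+ (n - m))).
  by split; [|split] => h'; apply: h; [left | right; left | right; right].
move: y2 h1 h2 h3; move: (iter m f x) (c * _) => y r y2.
move=> /negP; rewrite negb_and -!leNgt => h1.
move=> /negP; rewrite negb_and -!leNgt => h2.
move=> /negP; rewrite negb_and -!leNgt => h3.
move: y2; rewrite ler_norml => /andP[y1 y2].
(* For [y < 0] the end [1/2] is irrelevant, and conversely. *)
have [y0|y0] := ltP y 0.
  rewrite ltr0_norm//; move: h1 h3 => /orP[h1|h1] /orP[h3|h3]; apply/andP; split; lra.
by rewrite ger0_norm//; move: h1 h2 => /orP[h1|h1] /orP[h2|h2]; apply/andP; split; lra.
Qed.

(** The bound does not depend on [n]: by invariance each preimage has the measure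
    of a neighbourhood of width [c * q^(n - m)], and these widths are summable. *)
Lemma mu_bad_le : exists2 K : R, 0 <= K & forall n (c : R), 0 <= c ->
  (mu (bad n c) <= (K * c)%:E)%E.
Proof.
have [M M0 hM] := mu_cut_nbhd_le.
have q0 := qrate_gt0 hp; have q1 := qrate_lt1 hp.
exists (M / (1 - q)); first by rewrite divr_ge0//; lra.
move=> n c c0; rewrite /bad.
have mI i : measurable (iter i f @^-1` cut_nbhd (c * q ^+ (n - i)) :
    set (measurableTypeR R)).
  rewrite -[X in measurable X]setTI; apply: measurable_iter_fmap1 => //.
  exact: measurable_cut_nbhd.
apply: (le_trans (le_mu_bigsetU _ (fun i _ => mI i))).
apply: (@le_trans _ _ (\sum_(i < n.+1) (M * c * q ^+ (n - i))%:E)%E).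
  apply: lee_sum => i _; rewrite -mulrA.
  have qi : 0 <= c * q ^+ (n - i) by rewrite mulr_ge0// exprn_ge0// ltW.
  apply: (le_trans _ (hM _ qi)); rewrite le_eqVlt; apply/orP; left; apply/eqP.
  exact: mu_iter_preimage (measurable_cut_nbhd _).
rewrite sumEFin lee_fin -mulr_sumr.
have -> : M / (1 - q) * c = M * c * (1 - q)^-1 by ring.
by rewrite ler_wpM2l ?mulr_ge0// geometric_sum_le// ltW.
Qed.

Definition late_bad (c : R) N : set (measurableTypeR R) := \bigcap_k bad (N + k) c.

Lemma measurable_late_bad c N : measurable (late_bad c N).
Proof. by apply: bigcapT_measurable => k; exact: measurable_bad. Qed.

(** The set of points that are bad from some time on is an increasing union
    of sets that are each contained in some [bad n c]. *)
Lemma mu_eventually_bad_le : exists2 K : R, 0 <= K & forall c : R, 0 <= c ->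
  (mu (\bigcup_N late_bad c N) <= (K * c)%:E)%E.
Proof.
have [K K0 hK] := mu_bad_le; exists K => // c c0.
have mU : measurable (\bigcup_N late_bad c N).
  by apply: bigcupT_measurable => N; exact: measurable_late_bad.
have homo : {homo late_bad c : n m / (n <= m)%N >-> (n <= m)%O}.
  move=> n m nm; apply/subsetPset => x h k _.
  by have := h (m - n + k)%N I; rewrite addnA subnKC.
have cv := nondecreasing_cvg_mu (mu := mu) (measurable_late_bad c) mU homo.
rewrite -(cvg_lim _ cv)//; apply: lime_le; first by apply/cvg_ex; eexists; exact: cv.
apply: nearW => N /=; apply: (le_trans _ (hK N c c0)).
apply: le_measure; rewrite ?inE; [exact: measurable_late_bad|exact: measurable_bad|].
by move=> x /(_ 0%N I); rewrite addn0.
Qed.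

Lemma ae_often_away : {ae mu, forall x : R, x \in `[- (1 / 2), 1 / 2] ->
  exists2 c : R, 0 < c & forall N, exists2 n, (N <= n)%N & away p n c x}.
Proof.
have [K K0 hK] := mu_eventually_bad_le.
pose c_ j : R := j.+1%:R^-1.
have c0 j : 0 < c_ j by rewrite invr_gt0.
pose Z := \bigcap_j \bigcup_N late_bad (c_ j) N.
have mL j : measurable (\bigcup_N late_bad (c_ j) N).
  by apply: bigcupT_measurable => N; exact: measurable_late_bad.
have mZ : measurable Z by exact: bigcapT_measurable.
exists Z; split => //.
  apply/eqP; rewrite eq_le measure_ge0 andbT; apply/lee_addgt0Pr => e e0.
  rewrite add0e.
  have [j hj] : exists j, K * c_ j <= e.
    (* [K / j.+1 <= e] as soon as [j.+1 >= K / e]. *)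
    exists (Num.truncn (K / e)); rewrite /c_ ler_pdivrMr//.
    by have := truncnS_gt (K / e); rewrite ltr_pdivrMr// mulrC => /ltW.
  apply: (@le_trans _ _ (K * c_ j)%:E); last by rewrite lee_fin.
  apply: (le_trans _ (hK _ (ltW (c0 j)))).
  by apply: le_measure; rewrite ?inE// => x /(_ j I).
move=> x /= hx j _; apply: contrapT => hj; apply: hx => x2.
exists (c_ j) => // N.
have x2' : `|x| <= 1 / 2 by rewrite ler_norml; move: x2; rewrite in_itv.
apply: contrapT => hN; apply: hj; exists N => // k _.
apply: contrapT => hb; apply: hN; exists (N + k)%N; first exact: leq_addr.
exact: away_bad.
Qed.

End Recurrence.

(** * Lipschitz curves *)

Section Curves.
Variable R : realType.

Lemma lipschitz_continuous_within (V : normedModType R) (G : R -> V) (a b L : R) :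
  a <= b ->
  (forall x y, a <= x <= b -> a <= y <= b -> `|G x - G y| <= L * `|x - y|) ->
  {within `[a, b], continuous G}.
Proof.
(* The function is extended to the line by clamping its argument. *)
move=> ab GL; pose cl x := Num.min (Num.max x a) b.
have clab x : a <= cl x <= b by rewrite /cl le_min ge_min le_max !lexx ab !orbT.
have clE x : a <= x <= b -> cl x = x.
  by move=> /andP[ax xb]; rewrite /cl (max_l ax) (min_l xb).
have cll x y : `|cl x - cl y| <= `|x - y|.
  exact: le_trans (minr_lip _ _ _) (maxr_lip _ _ _).
apply: (@subspace_eq_continuous _ _ _ (G \o cl)).
  by move=> x; rewrite inE/= in_itv/= => /clE /= ->.
apply: continuous_subspaceT => x; apply/cvgrPdist_le => e e0.
near=> t; rewrite /= (le_trans (GL _ _ (clab _) (clab _)))//.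
have h : `|cl x - cl t| <= e / (`|L| + 1).
  rewrite (le_trans (cll _ _))//; near: t.
  by apply: cvgr_dist_le => //; rewrite divr_gt0// ltr_wpDl.
have Le : L <= `|L| + 1 by rewrite (le_trans (ler_norm L))// lerDl.
rewrite (le_trans (ler_wpM2r (normr_ge0 _) Le))//.
by rewrite -ler_pdivlMl 1?mulrC// ltr_wpDl.
Unshelve. all: by end_near. Qed.

Lemma image_itv01 (F : R -> R) : {within `[0, 1], continuous F} -> F 0 = 0 ->
  (forall x, 0 <= x <= 1 -> 0 <= F x) ->
  exists2 M, F 1 <= M & F @` `[0, 1] = `[0, M]%classic.
Proof.
move=> Fc F0 Fge; have [c cI cmax] := EVT_max ler01 Fc.
move: (cI); rewrite in_itv /= => /andP[c0 c1].
exists (F c); first by apply: cmax; rewrite in_itv /= lexx ler01.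
apply/seteqP; split => [_ [x xI <-]|v].
  by rewrite /= in_itv /= Fge ?cmax//; move: xI; rewrite /= in_itv.
rewrite /= in_itv /= => /andP[v0 vc].
have Fc' : {within `[0, c], continuous F}.
  apply: continuous_subspaceW Fc => x; rewrite /= !in_itv /= => /andP[-> xc].
  exact: le_trans xc c1.
have [|d dI <-] := @IVT R F 0 c v c0 Fc'.
  by rewrite F0 (min_l (le_trans v0 vc)) (max_r (le_trans v0 vc)) v0.
exists d => //; move: dI; rewrite /= !in_itv /= => /andP[-> dc].
exact: le_trans dc c1.
Qed.

Lemma exprn_eventually_lt (z e : R) : 0 <= z -> z < 1 -> 0 < e ->
  exists N, forall n, (N <= n)%N -> z ^+ n < e.
Proof.
move=> z0 z1 e0; have z1' : `|z| < 1 by rewrite ger0_norm.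
have /cvgrPdist_lt /(_ e e0) [N _ hN] := cvg_expr z1'.
exists N => n Nn; have := hN n Nn.
by rewrite /= sub0r normrN ger0_norm ?exprn_ge0.
Qed.

End Curves.

(** * Anti-leaf sets *)

Section AntiLeaf.
Variables (R : realType) (p : geo_params R).
Hypothesis hp : admissible p.
Local Notation q := (qrate p).
Local Notation f := (fmap1 p).

(** Let [d] be the distance of the first coordinates and [X] the time
    difference, in units of [1 / lambda1].  The first coordinates differ by at least
    [d - X], the third ones by at least [alpha * X / 2]; the two bounds cannot
    both be small. *)
Lemma lin_separation (a b : R * R * R) (t t' : R) : `|crd1 a| <= 1 / 2 ->
  crd3 a = 1 -> crd3 b = 1 -> 0 <= t -> 0 <= t' ->
  lambda1 p * t <= ln 2 -> lambda1 p * t' <= ln 2 ->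
  alpha p / 4 * `|crd1 a - crd1 b| <= `|lin p t a - lin p t' b|.
Proof.
move=> a1 a3 b3 t0 t'0 tl t'l.
have l1 := lambda1_gt0 hp; have l3 := lambda3_gt0 hp; have l31 := lambda31 hp.
have al0 := alpha_gt0 hp; have al1 := alpha_lt1 hp.
have X0 : 0 <= lambda1 p * `|t - t'| by rewrite mulr_ge0// ltW.
have first : `|crd1 a - crd1 b| - lambda1 p * `|t - t'| <= `|lin p t a - lin p t' b|.
  apply: (le_trans _ (norm3_ge1 _)).
  have -> : crd1 (lin p t a - lin p t' b) =
    (crd1 a - crd1 b) * expR (lambda1 p * t') +
    crd1 a * (expR (lambda1 p * t) - expR (lambda1 p * t')).
    by rewrite /lin /crd1 /=; ring.
  have e1 : 1 <= expR (lambda1 p * t').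
    by rewrite -expR0 ler_expR mulr_ge0// ltW.
  have e2 : `|expR (lambda1 p * t) - expR (lambda1 p * t')| <=
      2 * (lambda1 p * `|t - t'|).
    have := expR_lip tl t'l; rewrite lnK ?posrE//.
    by rewrite -mulrBr normrM (gtr0_norm l1).
  have e3 : `|crd1 a - crd1 b| <= `|(crd1 a - crd1 b) * expR (lambda1 p * t')|.
    by rewrite normrM ler_peMr// (le_trans e1)// ler_norm.
  have e4 : `|crd1 a * (expR (lambda1 p * t) - expR (lambda1 p * t'))| <=
      lambda1 p * `|t - t'|.
    rewrite normrM (le_trans (ler_pM (normr_ge0 _) (normr_ge0 _) a1 e2))//; lra.
  have := lerB_normD ((crd1 a - crd1 b) * expR (lambda1 p * t'))
    (crd1 a * (expR (lambda1 p * t) - expR (lambda1 p * t'))).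
  lra.
have third : alpha p / 2 * (lambda1 p * `|t - t'|) <= `|lin p t a - lin p t' b|.
  apply: (le_trans _ (norm3_ge3 _)).
  have -> : crd3 (lin p t a - lin p t' b) =
      expR (- (lambda3 p * t)) - expR (- (lambda3 p * t')).
    by rewrite -[LHS]/(crd3 a * _ - crd3 b * _) a3 b3 !mul1r.
  have low x : 0 <= x -> lambda1 p * x <= ln 2 -> - ln 2 <= - (lambda3 p * x).
    by move=> x0 xl; rewrite lerN2 (le_trans _ xl)// ler_wpM2r// ltW.
  have := expR_colip (low _ t0 tl) (low _ t'0 t'l).
  rewrite -opprD normrN -mulrBr normrM (gtr0_norm l3) expRN lnK ?posrE//.
  have -> : lambda3 p = alpha p * lambda1 p by rewrite /alpha divfK ?gt_eqF.
  by move=> h; rewrite (le_trans _ h)// le_eqVlt; apply/orP; left; apply/eqP; field.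
have d0 := normr_ge0 (crd1 a - crd1 b).
move: (`|lin p t a - _|) first third => N first third.
move: (`|crd1 a - _|) (lambda1 p * `|t - t'|) d0 X0 first third => d X d0 X0 h1 h2.
have [Xd|Xd] := leP X (d / 2).
  have : alpha p * d <= d by rewrite ler_piMl// ltW.
  lra.
have : alpha p * (d / 2) <= alpha p * X by rewrite ler_wpM2l// ltW.
lra.
Qed.

(** A third of the shortest linear phase: the sampling time is placed in the
    middle third, and the time lags stay below one third. *)
Definition margin : R := ln 2 / (3 * lambda1 p).

Lemma margin_gt0 : 0 < margin.
Proof.
have l1 := lambda1_gt0 hp.
by rewrite divr_gt0 ?mulr_gt0// ln_gt0//; lra.
Qed.

Lemma lambda1_margin : lambda1 p * (3 * margin) = ln 2.
Proof. by have l1 := lambda1_gt0 hp; rewrite /margin; field; rewrite gt_eqF. Qed.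

Section OneLeaf.
Variables (u : R * R * R) (s c h dl : R) (n k : nat).
Hypotheses (uS : Ssec u) (us : before_return p u s) (c0 : 0 < c)
  (hu : away p n c (crd1 u)) (h0 : 0 < h) (dl0 : 0 < dl) (dlc : dl <= c / 2)
  (dlT : tauC p (c / 2) / (1 - q ^+ 3) * dl <= margin)
  (nret : tauC p (c / 2) * ((q ^+ 3) ^+ n * dl) < return_time p u - s)
  (kT1 : nth_return_time p n u + margin <= s + k%:R * h)
  (kT2 : s + k%:R * h <= nth_return_time p n u + 2 * margin).

Let y0 := iter n f (crd1 u).
Let V (x : R) := leaf p n u (y0 + dl * x).
Let dist (v : R * R * R) (i : nat) : R :=
  `|Psi p (i%:R * h) v - Psi p (i%:R * h) (geo_path p u s)|.

Let s0 : 0 <= s. Proof. by case: us. Qed.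

Let near (x : R) : 0 <= x <= 1 -> `|y0 + dl * x - y0| <= c / 2.
Proof.
move=> /andP[x0 x1]; rewrite addrC addKr normrM gtr0_norm// ger0_norm//.
by rewrite (le_trans _ dlc)// ler_piMr// ltW.
Qed.

Let c20 : 0 < c / 2. Proof. by rewrite divr_gt0. Qed.

Let V0 : V 0 = u.
Proof. by rewrite /V mulr0 addr0 (leaf_base hp c0 uS hu). Qed.

Let Vreg (x : R) : 0 <= x <= 1 -> regular p n (V x).
Proof. by move=> /near hx; exact: leaf_regular hx. Qed.

Let Vshadow (x x' : R) : 0 <= x <= 1 -> 0 <= x' <= 1 ->
  shadow p n (c / 2) (dl * `|x - x'|) (V x) (V x').
Proof.
move=> /near hx /near hx'; have := leaf_shadow hp c0 uS hu hx hx'.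
have -> : y0 + dl * x - (y0 + dl * x') = dl * (x - x') by ring.
by rewrite normrM (gtr0_norm dl0).
Qed.

Let I0 : 0 <= (0 : R) <= 1. Proof. by rewrite lexx ler01. Qed.

Let dist0 (x : R) : 0 <= x <= 1 -> dl * `|0 - x| = dl * x.
Proof. by move=> /andP[x0 _]; rewrite sub0r normrN ger0_norm. Qed.

Let Vbefore (x : R) : 0 <= x <= 1 -> before_return p (V x) s.
Proof.
move=> hx; split=> // _.
have := shadow_tau hp c20 (Vshadow I0 hx) (leq0n n); rewrite /= V0 subn0 dist0//.
have : tauC p (c / 2) * ((q ^+ 3) ^+ n * (dl * x)) <=
    tauC p (c / 2) * ((q ^+ 3) ^+ n * dl).
  rewrite !ler_wpM2l ?tauC_ge0 ?exprn_ge0 ?(ltW (qrate_gt0 hp))//.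
  by case/andP: hx => x0 x1; rewrite ler_piMr// ltW.
have e v : return_time p v = tauSigma p v + 3 / 2 * pi by [].
move: nret; rewrite !e => h1 h2 h3.
have := ler_norm (tauSigma p u - tauSigma p (V x)); lra.
Qed.

Let Vtime (x : R) : 0 <= x <= 1 ->
  0 <= s + k%:R * h - nth_return_time p n (V x) <= 3 * margin.
Proof.
move=> hx; have := shadow_time hp c20 (Vshadow I0 hx) (leqnn n).
rewrite V0 subnn expr0 mul1r dist0//.
have : tauC p (c / 2) / (1 - q ^+ 3) * (dl * x) <= margin.
  rewrite (le_trans _ dlT)// ler_wpM2l//.
    by rewrite divr_ge0 ?tauC_ge0// subr_ge0 ltW// q3_lt1.
  by case/andP: hx => x0 x1; rewrite ler_piMr// ltW.
move=> h1 /le_trans/(_ h1); rewrite ler_norml => /andP[h2 h3].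
by apply/andP; move: (kT1) (kT2); split; lra.
Qed.

Let Vtau (x : R) : 0 <= x <= 1 ->
  3 * margin <= tauSigma p (iter n (return_map p) (V x)).
Proof.
move=> hx; have [oS o0] := regular_orbit hp (Vreg hx) (leqnn n).
rewrite -(ler_pM2l (lambda1_gt0 hp)) lambda1_margin.
exact: lambda1_tauSigma.
Qed.

Let Vlast (x : R) i : 0 <= x <= 1 -> (i <= k)%N ->
  s + i%:R * h < nth_return_time p n.+1 (V x).
Proof.
move=> hx ik; have /andP[_ h1] := Vtime hx; have h2 := Vtau hx.
rewrite nth_return_timeS.
have : i%:R * h <= k%:R * h by rewrite ler_wpM2r ?ler_nat// ltW.
have := rot_time_ge1 R.
rewrite /return_time; lra.
Qed.

Let VPsi (x : R) i : 0 <= x <= 1 -> (i <= k)%N ->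
  Psi p (i%:R * h) (geo_path p (V x) s) = flow p n (V x) (s + i%:R * h).
Proof.
move=> hx ik; apply: Psi_flow => //.
- exact: Vreg.
- exact: Vbefore.
- by rewrite mulr_ge0// ltW.
- exact: Vlast.
Qed.

Let distE (x : R) i : 0 <= x <= 1 -> (i <= k)%N ->
  dist (geo_path p (V x) s) i =
  `|flow p n u (s + i%:R * h) - flow p n (V x) (s + i%:R * h)|.
Proof.
move=> hx ik; have := VPsi I0 ik; rewrite V0 => e.
by rewrite /dist VPsi// e distrC.
Qed.

Let Vlip (x x' : R) i : 0 <= x <= 1 -> 0 <= x' <= 1 -> (i <= k)%N ->
  `|flow p n (V x) (s + i%:R * h) - flow p n (V x') (s + i%:R * h)| <=
  shadowC p (c / 2) * dl * `|x - x'|.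
Proof.
move=> hx hx' ik; rewrite -mulrA.
apply: (shadow_flow_le hp c20 (Vshadow hx hx')); last exact: Vlast.
by rewrite addr_ge0// mulr_ge0// ltW.
Qed.

Let Vstart (x : R) : 0 <= x <= 1 -> geo_path p (V x) s = flow p n (V x) (s + 0%:R * h).
Proof.
move=> hx; have [VS V1] := regular_orbit hp (Vreg hx) (leq0n n).
have [_ /(_ V1) sr] := Vbefore hx.
rewrite (geo_path_turn hp VS V1 (ltW sr)) mul0r addr0.
have := @flow_turn _ p hp n (V x) 0%N s (Vreg hx) (leq0n n) s0 (ltW sr).
by rewrite nth_return_time0 add0r => ->.
Qed.

Let dist_low (x : R) : 0 <= x <= 1 ->
  alpha p / 4 * (dl * x) <= dist (geo_path p (V x) s) k.
Proof.
move=> hx; rewrite distE// -(dist0 hx).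
have posl z : 0 <= z <= 1 ->
    flow p n (V z) (s + k%:R * h) =
    lin p (s + k%:R * h - nth_return_time p n (V z)) (iter n (return_map p) (V z)).
  move=> hz; have [oS o0] := regular_orbit hp (Vreg hz) (leqnn n).
  have /andP[t0 t3] := Vtime hz; have tt := le_trans t3 (Vtau hz).
  rewrite -(turn_lin hp oS o0 tt) -(flow_turn hp (Vreg hz) (leqnn n) t0).
    by rewrite addrCA subrr addr0.
  by rewrite (le_trans tt)// lerDl; have := rot_time_ge1 R; lra.
have [oS o0] := regular_orbit hp (Vreg I0) (leqnn n).
have [oS' o0'] := regular_orbit hp (Vreg hx) (leqnn n).
have /andP[t0 t3] := Vtime I0; have /andP[t0' t3'] := Vtime hx.
rewrite -{1}V0 !posl//.
have -> : dl * `|0 - x| = `|crd1 (iter n (return_map p) (V 0)) -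
                            crd1 (iter n (return_map p) (V x))|.
  rewrite /V !(leaf_end hp c0 hu) ?near//.
  have -> : y0 + dl * 0 - (y0 + dl * x) = dl * (0 - x) by ring.
  by rewrite normrM (gtr0_norm dl0).
have [a1 _ a3] := oS; have [_ _ b3] := oS'.
have l1 := ltW (lambda1_gt0 hp).
by apply: lin_separation => //; rewrite -lambda1_margin ler_wpM2l.
Qed.

(** The hypotheses on [dl] keep the pull-back inside the branches, the time lag
    at return [n] below [margin], and the point reached after time [s] before the
    first return; those on [k] place time [t_k] in the middle third of the
    shortest linear phase after return [n] of [u]. *)
Lemma leaf_is_antileaf : exists A dm, [/\ is_curve A /\ A `<=` Lambda p,
  alpha p / 4 * dl <= dm, [set dist v k | v in A] = `[0, dm]%classic &
  forall v, A v -> \sum_(0 <= i < k.+1) dist v i <=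
    shadow_sumC p (c / 2) h * (4 / alpha p) * dist v k].
Proof.
pose g x := geo_path p (V x) s; pose F x := dist (g x) k.
have I (x : R) : `[0, 1]%classic x -> 0 <= x <= 1 by rewrite /= in_itv.
have gc : {within `[0, 1], continuous g}.
  apply: (lipschitz_continuous_within (L := shadowC p (c / 2) * dl)) ler01 _.
  by move=> x x' hx hx'; rewrite /g !Vstart// Vlip.
have Fc : {within `[0, 1], continuous F}.
  apply: (lipschitz_continuous_within (L := shadowC p (c / 2) * dl)) ler01 _.
  move=> x x' hx hx'; rewrite /F /g !distE//.
  set a := flow p n u _.
  apply: (le_trans (ler_dist_dist _ _)).
  have -> : a - flow p n (V x) (s + k%:R * h) - (a - flow p n (V x') (s + k%:R * h))
    = - (flow p n (V x) (s + k%:R * h) - flow p n (V x') (s + k%:R * h)).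
    by rewrite !opprB addrC addrA subrK.
  by rewrite normrN Vlip.
have F0 : F 0 = 0 by rewrite /F /g distE// V0 subrr normr0.
have [dm F1 Fdm] := image_itv01 Fc F0 (fun x _ => normr_ge0 _).
exists (g @` `[0, 1]), dm; split.
- split; first by exists g.
  move=> _ [x /I hx <-]; exists (V x), s; split => //; last exact: Vbefore.
  by case: (Vreg hx).
- rewrite (le_trans _ F1)//.
  have I1 : 0 <= (1 : R) <= 1 by rewrite lexx ler01.
  by have := dist_low I1; rewrite mulr1.
- by rewrite image_comp -Fdm.
move=> _ [x /I hx <-]; rewrite big_nat.
rewrite (eq_bigr (fun i => `|flow p n (V 0) (s + i%:R * h) -
    flow p n (V x) (s + i%:R * h)|)); last first.
  by move=> i /andP[_ ik]; rewrite distE// V0.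
rewrite -big_nat.
have hs := shadow_sum (N := k.+1) hp c20 (Vshadow I0 hx) h0 s0
  (fun i (ik : (i < k.+1)%N) => Vlast I0 ik).
apply: (le_trans hs); rewrite -(mulrA (shadow_sumC p (c / 2) h)) ler_wpM2l ?shadow_sumC_ge0//.
have := dist_low hx; rewrite dist0//.
have al0 := alpha_gt0 hp.
have a4 : 0 < alpha p / 4 by apply: divr_gt0.
by rewrite -(invf_div (alpha p)) (ler_pdivlMl _ _ a4).
Qed.

End OneLeaf.

(** A fixed leaf length [dl] serves for all [n]; large [n] only make the
    initial points closer to [u] and the times [t_k] larger. *)
Lemma antileaf_often (u : R * R * R) (s c h : R) : Ssec u -> before_return p u s ->
  0 < c -> (forall N, exists2 n, (N <= n)%N & away p n c (crd1 u)) ->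
  0 < h -> h <= margin ->
  let dist (v : R * R * R) (i : nat) : R :=
    `|Psi p (i%:R * h) v - Psi p (i%:R * h) (geo_path p u s)| in
  exists2 dmin : R, 0 < dmin & exists CU, forall K, exists2 k, (K <= k)%N &
  exists A dm, [/\ is_curve A /\ A `<=` Lambda p,
    dmin <= dm, [set dist v k | v in A] = `[0, dm]%classic &
    forall v, A v -> \sum_(0 <= i < k.+1) dist v i <= CU * dist v k].
Proof.
move=> uS us c0 often h0 hw dist.
have w0 := margin_gt0; have al0 := alpha_gt0 hp; have s0 : 0 <= s by case: us.
have c20 : 0 < c / 2 by lra.
have u0 : crd1 u != 0.
  by have [n _ hn] := often 0%N; exact: (away_neq0 hp c0 hn).
have ret0 : 0 < return_time p u - s by rewrite subr_gt0; case: us => _; apply.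
have K10 := tauC_ge0 hp c20; have q31 := q3_lt1 hp.
pose KT := tauC p (c / 2) / (1 - q ^+ 3).
have KT0 : 0 <= KT by rewrite divr_ge0// subr_ge0 ltW.
pose dl := Num.min (c / 2) (margin / (KT + 1)).
have dl0 : 0 < dl by rewrite lt_min c20 divr_gt0//; lra.
have dlc : dl <= c / 2 by rewrite ge_min lexx.
have dlT : KT * dl <= margin.
  have : dl <= margin / (KT + 1) by rewrite ge_min lexx orbT.
  rewrite ler_pdivlMr; last by lra.
  lra.
exists (alpha p / 4 * dl); first by apply: mulr_gt0 => //; apply: divr_gt0.
exists (shadow_sumC p (c / 2) h * (4 / alpha p)) => K.
have eps0 : 0 < (return_time p u - s) / (tauC p (c / 2) * dl + 1).
  by rewrite divr_gt0// ltr_wpDl// mulr_ge0// ltW.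
have q30 : 0 <= q ^+ 3 by rewrite exprn_ge0// ltW// qrate_gt0.
have [N1 hN1] := exprn_eventually_lt q30 q31 eps0.
(* [n >= s + K * h] forces the sampling time after return [n] beyond [K]. *)
have [n nN hn] := often (maxn N1 (Num.truncn (s + K%:R * h)).+1).
have nN1 : (N1 <= n)%N by rewrite (leq_trans _ nN)// leq_maxl.
have nN2 : s + K%:R * h < n%:R.
  apply: (lt_le_trans (truncnS_gt _)); rewrite ler_nat (leq_trans _ nN)//.
  exact: leq_maxr.
have ureg : regular p n u.
  rewrite -{1}(leaf_base hp c0 uS hn); apply: (leaf_regular hp c0 uS hn).
  by rewrite subrr normr0 ltW.
have nT : n%:R <= nth_return_time p n u.
  have [_ hr] := ureg.
  have := nth_return_time_ge hp uS (leq0n n) (fun i (im : (i < n)%N) => hr i (ltnW im)).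
  by rewrite nth_return_time0 add0r subn0.
have nret : tauC p (c / 2) * ((q ^+ 3) ^+ n * dl) < return_time p u - s.
  have := hN1 n nN1; rewrite ltr_pdivlMr; last by rewrite ltr_wpDl// mulr_ge0// ltW.
  have : 0 <= (q ^+ 3) ^+ n by rewrite exprn_ge0.
  move: (_ ^+ n) => z z0; lra.
(* The first sampling time that is at least [margin] after return [n]. *)
pose X := (nth_return_time p n u + margin - s) / h.
have X0 : 0 <= X.
  rewrite divr_ge0 ?(ltW h0)//.
  have : 0 <= K%:R * h by rewrite mulr_ge0// ltW.
  lra.
have X1 := truncnS_gt X.
have := truncn_le X; rewrite X0 => X2.
have kT1 : nth_return_time p n u + margin <= s + (Num.truncn X).+1%:R * h.
  move: X1; rewrite /X ltr_pdivrMr//; lra.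
have kT2 : s + (Num.truncn X).+1%:R * h <= nth_return_time p n u + 2 * margin.
  move: X2; rewrite {2}/X ler_pdivlMr// -natr1; lra.
exists (Num.truncn X).+1; last exact: (leaf_is_antileaf uS us c0 hn h0 dl0 dlc dlT nret).
rewrite -(ler_nat R) -(ler_pM2r h0); lra.
Qed.

End AntiLeaf.

Lemma infinitely_often_homo (P : nat -> Prop) :
  (forall K, exists2 k, (K <= k)%N & P k) ->
  exists2 i_ : nat -> nat, {homo i_ : j1 j2 / (j1 < j2)%N >-> (j1 < j2)%N} &
    forall j, P (i_ j).
Proof.
move=> hP.
have /choice[nxt hnxt] : forall K, exists k, (K <= k)%N /\ P k.
  by move=> K; have [k] := hP K; exists k.
exists (fun j => iter j (fun m => nxt m.+1) (nxt 0%N)).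
  apply: homo_ltn => [? ? ? |j]; first exact: ltn_trans.
  by rewrite iterS; have [] := hnxt (iter j (fun m => nxt m.+1) (nxt 0%N)).+1.
case=> [|j]; first by have [] := hnxt 0%N.
by rewrite iterS; have [] := hnxt (iter j (fun m => nxt m.+1) (nxt 0%N)).+1.
Qed.

Theorem theorem2p3 (R : realType) (p : geo_params R) (hp : admissible p)
    (mu : probability (measurableTypeR R) R) (hmu : is_mu_f p mu) :
  exists2 hmax : R, 0 < hmax &
  forall h : R, 0 < h <= hmax ->
  {ae mu, forall x : R, x \in `[-(1 / 2), 1 / 2] ->
    forall u : R * R * R, Lambda p u -> crd1 (origin p u) = x ->
    let dist (v : R * R * R) (i : nat) : R :=
      `|Psi p (i%:R * h) v - Psi p (i%:R * h) u| in
    exists (U : nat -> set (R * R * R)) (dmax C : nat -> R),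
      [/\ forall k, [/\ is_curve (U k), U k `<=` Lambda p & 0 <= dmax k],
          forall k, [set dist v k | v in U k] = `[0, dmax k]%classic,
          forall k v, U k v ->
            \sum_(0 <= i < k.+1) dist v i <= C k * dist v k
        & exists (i_ : nat -> nat) (dmin CU : R),
            [/\ {homo i_ : j1 j2 / (j1 < j2)%N >-> (j1 < j2)%N}, 0 < dmin
              & forall j, C (i_ j) <= CU /\ dmin <= dmax (i_ j)]]}.
Proof.
exists (margin p); first exact: margin_gt0.
move=> h /andP[h0 hw]; have [Z [mZ Z0 hZ]] := ae_often_away hp hmu.
exists Z; split => // x nx; apply: hZ => hx; apply: nx => xI u Lu Ox.
pose dist (v : R * R * R) (i : nat) : R :=
  `|Psi p (i%:R * h) v - Psi p (i%:R * h) u|.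
have [c c0 often] := hx xI.
have [uS [s us e]] : [set u0 | Ssec u0 /\ exists2 t, before_return p u0 t &
    geo_path p u0 t = u] (origin p u).
  by apply: getPex; have [v [t [vS vt vu]]] := Lu; exists v; split => //; exists t.
rewrite -Ox in often.
have [dmin dmin0 [CU good]] := antileaf_often hp uS us c0 often h0 hw.
rewrite e in good.
pose P k (z : set (R * R * R) * R * R) :=
  [/\ [/\ is_curve z.1.1, z.1.1 `<=` Lambda p & 0 <= z.1.2],
      [set dist v k | v in z.1.1] = `[0, z.1.2]%classic &
      forall v, z.1.1 v -> \sum_(0 <= i < k.+1) dist v i <= z.2 * dist v k].
pose G k := exists2 z, P k z & z.2 <= CU /\ dmin <= z.1.2.
have trivial_P k : P k ([set u], 0, 0).
  have du i : dist u i = 0 by rewrite /dist subrr normr0.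
  split => /=.
  - split => //; last by move=> _ ->.
    exists (fun=> u); split; first exact: cst_continuous.
    apply/seteqP; split => [_ ->|_ [t _ <-]//].
    by exists 0 => //; rewrite /= in_itv /= lexx ler01.
  - rewrite image_set1 du; apply/seteqP; split => [_ ->|t] /=.
      by rewrite in_itv /= lexx.
    by rewrite in_itv /= => t0; apply/eqP; rewrite eq_le andbC.
  - by move=> _ ->; rewrite big1 ?mul0r// => i _; rewrite du.
have /choice[z hz] : forall k, exists z, P k z /\ (G k -> z.2 <= CU /\ dmin <= z.1.2).
  move=> k; have [[z Pz Gz]|nG] := pselect (G k); first by exists z.
  by exists ([set u], 0, 0).
have Gi K : exists2 k, (K <= k)%N & G k.
  have [k Kk [A [dm [[A1 A2] A3 A4 A5]]]] := good K; exists k => //.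
  exists (A, dm, CU); last by split.
  by split => //=; split => //; exact: le_trans (ltW dmin0) A3.
have [i_ i_homo Gi_] := infinitely_often_homo Gi.
exists (fun k => (z k).1.1), (fun k => (z k).1.2), (fun k => (z k).2); split.
- by move=> k; have [[]] := hz k.
- by move=> k; have [[]] := hz k.
- by move=> k; have [[]] := hz k.
exists i_, dmin, CU; split => // j.
by have [_ /(_ (Gi_ j))] := hz (i_ j).
Qed.
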